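(* The system $\mathsf{P}+\mathsf{NPC}+\mathsf{STP}$ proves: for every standard $Y^2$ with $Y\in C$, every standard $s^0$, and all $M^0,N^0\in\Omega$, \[ H(Y,s,N)=_0H(Y,s,M)\qquad\text{and}\qquad G(Y,s,N)=_0G(Y,s,M), \] i.e. the functionals $H(\cdot,\cdot,M)$ and $G(\cdot,\cdot,M)$ do not depend (on standard inputs) on the choice of the infinite number $M$.
   Context: Framework. $\mathsf{E\text{-}PA}^{\omega*}$ is Peano arithmetic in all finite types with the axiom of extensionality, with additional types $\rho^*$ of finite sequences of objects of type $\rho$; type $0$ is the natural numbers, $1=0\to0$, $2=1\to0$, $3=2\to0$, $4=3\to0$; superscripts indicate types. Its closed terms are (essentially) the terms of Gödel's system $\mathsf T$. The language of $\mathsf P$ adds a predicate $\mathrm{st}$ (''standard'') for every type; $(\forall^{\mathrm{st}}x)\varphi$ abbreviates $(\forall x)(\mathrm{st}(x)\to\varphi)$ and $(\exists^{\mathrm{st}}x)\varphi$ abbreviates $(\exists x)(\mathrm{st}(x)\wedge\varphi)$; a formula is internal if it does not contain $\mathrm{st}$. $\mathsf P$ is $\mathsf{E\text{-}PA}^{\omega*}$ plus: (i) $\mathrm{st}(x)\wedge x=y\to\mathrm{st}(y)$; (ii) $\mathrm{st}(t)$ for each closed term $t$ of $\mathsf{E\text{-}PA}^{\omega*}$; (iii) $\mathrm{st}(f)\wedge\mathrm{st}(x)\to\mathrm{st}(f(x))$; (iv) external induction: $[\Phi(0)\wedge(\forall^{\mathrm{st}}n^0)(\Phi(n)\to\Phi(n+1))]\to(\forall^{\mathrm{st}}m^0)\Phi(m)$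 for every formula $\Phi$; (v) $\mathsf{HAC}_{\mathrm{int}}$: for internal $\varphi$, $(\forall^{\mathrm{st}}x^\rho)(\exists^{\mathrm{st}}y^\tau)\varphi(x,y)\to(\exists^{\mathrm{st}}F^{\rho\to\tau^*})(\forall^{\mathrm{st}}x^\rho)(\exists y\in F(x))\varphi(x,y)$; (vi) idealisation: for internal $\varphi$ with arbitrary parameters, $(\forall^{\mathrm{st}}x^{\sigma^*})(\exists y^\tau)(\forall z^\sigma\in x)\varphi(z,y)\to(\exists y^\tau)(\forall^{\mathrm{st}}x^\sigma)\varphi(x,y)$. Notation: $N^0\in\Omega$ means $\neg\mathrm{st}(N)$ ($N$ is infinite). For $x,y$ of type $\tau_1\to\dots\to\tau_k\to0$, $x\approx y$ means $(\forall^{\mathrm{st}}z_1\dots z_k)(xz_1\dots z_k=_0yz_1\dots z_k)$. Finite sequences of numbers are coded by numbers; $|s|$ is the length, $s*t$ concatenation, $\overline{s}M$ and $\overline\alpha M$ initial segments of length $M$, $s*00\dots$ the sequence $s$ followed by zeros; $f\le_1 1$ means $(\forall n)f(n)\le1$. $Y^2\in C$ means $(\forall f^1)(\exists N^0)(\forall g^1)(\overline gN=\overline fN\to Y(f)=Y(g))$. Principles: $\mathsf{STP}$: $(\forall f^1\le_1 1)(\exists^{\mathrm{st}}g^1\le_1 1)(f\approx_1 g)$. $\mathsf{NPC}$: $(\forall^{\mathrm{st}}Y^2\in C,f^1)(\forall g^1)(f\approx_1 g\to Y(f)=_0Y(g))$. Functionals (primitive recursive): $H(Y,s,M)=Y(\overline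 sM*00\dots)$ if $|s|\ge M$, and $H(Y,s,M)=Y(s*0*H(Y,s*1,M)*\dots*H(Y,s*M,M)*00\dots)$ otherwise; $G(Y,s,N)=Y(s*00\dots)$ if $|s|\ge N$, and $G(Y,s,N)=Y(s*0*(\lambda n)G(Y,s*(n+1),N))$ otherwise. *)

(* Defs.v *)
From Stdlib Require Import List Arith Lia FunctionalExtensionality.
Import ListNotations.

Set Implicit Arguments.
Unset Strict Implicit.

(** * Finite types and terms *)

Inductive ty : Type :=
| N0 : ty
| Arr : ty -> ty -> ty
| Seq : ty -> ty.

Declare Scope ty_scope.
Delimit Scope ty_scope with ty.
Bind Scope ty_scope with ty.
Infix "⇒" := Arr (at level 60, right associativity) : ty_scope.
Notation "s '^*'" := (Seq s) (at level 5, format "s '^*'") : ty_scope.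

Definition T1 : ty := (N0 ⇒ N0)%ty.
Definition T2 : ty := (T1 ⇒ N0)%ty.

Definition ctx := list ty.

(* Typed de Bruijn indices: the innermost bound variable is the head of the
   context. *)
Inductive var : ctx -> ty -> Type :=
| vz (G : ctx) (s : ty) : var (s :: G) s
| vs (G : ctx) (s r : ty) : var G s -> var (r :: G) s.

Arguments vz {G s}.
Arguments vs {G s r} _.

(* The recursors are R_s : 0 -> s -> (s -> 0 -> s) -> s on numbers and
   L_{s,r} : s^* -> r -> (r -> s^* -> s -> r) -> r on finite sequences. *)
Inductive tm (G : ctx) : ty -> Type :=
| Var (s : ty) : var G s -> tm G s
| App (s r : ty) : tm G (s ⇒ r) -> tm G s -> tm G r
| Lam (s r : ty) : tm (s :: G) r -> tm G (s ⇒ r)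
| Zero : tm G N0
| Succ : tm G (N0 ⇒ N0)
| Rec (s : ty) : tm G (N0 ⇒ s ⇒ (s ⇒ N0 ⇒ s) ⇒ s)
| Nil (s : ty) : tm G s^*
| Cons (s : ty) : tm G (s ⇒ s^* ⇒ s^*)
| LRec (s r : ty) : tm G (s^* ⇒ r ⇒ (r ⇒ s^* ⇒ s ⇒ r) ⇒ r).

Arguments Var {G s} _.
Arguments App {G s r} _ _.
Arguments Lam {G} s {r} _.
Arguments Zero {G}.
Arguments Succ {G}.
Arguments Rec {G s}.
Arguments Nil {G s}.
Arguments Cons {G s}.
Arguments LRec {G s r}.

Declare Scope tm_scope.
Delimit Scope tm_scope with tm.
Bind Scope tm_scope with tm.
Notation "t · u" := (App t%tm u%tm) (at level 38, left associativity) : tm_scope.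
Notation "'λ' s , t" := (Lam s%ty t%tm)
  (at level 90, s at level 60, t at level 200, right associativity) : tm_scope.
Notation "#0" := (Var vz) : tm_scope.
Notation "#1" := (Var (vs vz)) : tm_scope.
Notation "#2" := (Var (vs (vs vz))) : tm_scope.
Notation "#3" := (Var (vs (vs (vs vz)))) : tm_scope.
Notation "#4" := (Var (vs (vs (vs (vs vz))))) : tm_scope.
Notation "#5" := (Var (vs (vs (vs (vs (vs vz)))))) : tm_scope.

Definition renaming (G D : ctx) := forall s, var G s -> var D s.
Definition subst (G D : ctx) := forall s, var G s -> tm D s.

Definition shift (G : ctx) (r : ty) : renaming G (r :: G) := fun s x => vs x.
Arguments shift {G r} [s] _.

Definition upr (G D : ctx) (r : ty) (f : renaming G D) :
    renaming (r :: G) (r :: D) := fun s x =>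
  match x in var G' s' return
    match G' with
    | nil => unit
    | r' :: G0 => (var G0 s' -> var D s') -> var (r' :: D) s'
    end
  with
  | vz => fun _ => vz
  | vs y => fun g => vs (g y)
  end (@f s).

Fixpoint ren (G D : ctx) (f : renaming G D) (s : ty) (t : tm G s) : tm D s :=
  match t in tm _ s return tm D s with
  | Var x => Var (f _ x)
  | App t u => App (ren f t) (ren f u)
  | Lam r t => Lam r (ren (upr (r:=r) f) t)
  | Zero => Zero
  | Succ => Succ
  | Rec => Rec
  | Nil => Nil
  | Cons => Cons
  | LRec => LRec
  end.

Notation "↑ t" := (ren shift t%tm) (at level 8, right associativity) : tm_scope.

Definition ups (G D : ctx) (r : ty) (f : subst G D) :
    subst (r :: G) (r :: D) := fun s x =>
  match x in var G' s' return
    match G' with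
    | nil => unit
    | r' :: G0 => (var G0 s' -> tm D s') -> tm (r' :: D) s'
    end
  with
  | vz => fun _ => Var vz
  | vs y => fun g => ren shift (g y)
  end (@f s).

Fixpoint sub (G D : ctx) (f : subst G D) (s : ty) (t : tm G s) : tm D s :=
  match t in tm _ s return tm D s with
  | Var x => f _ x
  | App t u => App (sub f t) (sub f u)
  | Lam r t => Lam r (sub (ups (r:=r) f) t)
  | Zero => Zero
  | Succ => Succ
  | Rec => Rec
  | Nil => Nil
  | Cons => Cons
  | LRec => LRec
  end.

Definition inst (G : ctx) (r : ty) (u : tm G r) : subst (r :: G) G := fun s x =>
  match x in var G' s' return
    match G' with
    | nil => unit
    | r' :: G0 => tm G0 r' -> tm G0 s'
    end
  with
  | vz => fun u => u
  | vs y => fun _ => Var y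
  end u.

Definition from_nil {G : ctx} : renaming nil G := fun s x =>
  match x in var G' s' return
    match G' with nil => var G s' | _ :: _ => unit end
  with
  | vz => tt
  | vs _ => tt
  end.

Definition closed_tm (G : ctx) (s : ty) (t : tm nil s) : tm G s :=
  ren from_nil t.
Arguments closed_tm {G s} t.

(** * Formulas *)

Inductive form (G : ctx) : Type :=
| Eq (s : ty) : tm G s -> tm G s -> form G
| St (s : ty) : tm G s -> form G
| Bot : form G
| Imp : form G -> form G -> form G
| And : form G -> form G -> form G
| Or : form G -> form G -> form G
| All (s : ty) : form (s :: G) -> form G
| Ex (s : ty) : form (s :: G) -> form G.

Arguments Eq {G s} _ _.
Arguments St {G s} _.
Arguments Bot {G}.
Arguments Imp {G} _ _.
Arguments And {G} _ _.
Arguments Or {G} _ _.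
Arguments All {G} s _.
Arguments Ex {G} s _.

Definition Not {G : ctx} (p : form G) : form G := Imp p Bot.
Definition AllSt {G : ctx} (s : ty) (p : form (s :: G)) : form G :=
  All s (Imp (St (Var vz)) p).
Arguments AllSt {G} s p.
Definition ExSt {G : ctx} (s : ty) (p : form (s :: G)) : form G :=
  Ex s (And (St (Var vz)) p).
Arguments ExSt {G} s p.

Declare Scope form_scope.
Delimit Scope form_scope with form.
Bind Scope form_scope with form.
Infix "≐" := Eq (at level 70, no associativity) : form_scope.
Infix "⟶" := Imp (at level 85, right associativity) : form_scope.
Infix "⩓" := And (at level 80, right associativity) : form_scope.
Infix "⩔" := Or (at level 82, right associativity) : form_scope.
Notation "⊥" := Bot : form_scope.
Notation "¬ p" := (Not p) (at level 75, right associativity) : form_scope.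
Notation "∀ s , p" := (All s%ty p%form)
  (at level 90, s at level 60, p at level 200, right associativity) : form_scope.
Notation "∃ s , p" := (Ex s%ty p%form)
  (at level 90, s at level 60, p at level 200, right associativity) : form_scope.
Notation "'∀st' s , p" := (AllSt s%ty p%form)
  (at level 90, s at level 60, p at level 200, right associativity) : form_scope.
Notation "'∃st' s , p" := (ExSt s%ty p%form)
  (at level 90, s at level 60, p at level 200, right associativity) : form_scope.

Fixpoint internal (G : ctx) (p : form G) : Prop :=
  match p with
  | Eq _ _ => True
  | St _ => False
  | Bot => True
  | Imp p q | And p q | Or p q => internal p /\ internal q
  | All _ p | Ex _ p => internal p
  end.

Fixpoint fren (G D : ctx) (f : renaming G D) (p : form G) : form D :=
  match p with
  | Eq t u => Eq (ren f t) (ren f u)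
  | St t => St (ren f t)
  | Bot => Bot
  | Imp p q => Imp (fren f p) (fren f q)
  | And p q => And (fren f p) (fren f q)
  | Or p q => Or (fren f p) (fren f q)
  | All s p => All s (fren (upr (r:=s) f) p)
  | Ex s p => Ex s (fren (upr (r:=s) f) p)
  end.

Fixpoint fsub (G D : ctx) (f : subst G D) (p : form G) : form D :=
  match p with
  | Eq t u => Eq (sub f t) (sub f u)
  | St t => St (sub f t)
  | Bot => Bot
  | Imp p q => Imp (fsub f p) (fsub f q)
  | And p q => And (fsub f p) (fsub f q)
  | Or p q => Or (fsub f p) (fsub f q)
  | All s p => All s (fsub (ups (r:=s) f) p)
  | Ex s p => Ex s (fsub (ups (r:=s) f) p)
  end.

Notation "p ⟨ u ⟩" := (fsub (inst u%tm) p)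
  (at level 7, left associativity, format "p ⟨ u ⟩") : form_scope.

(* [p], with one distinguished variable, at the successor of that variable. *)
Definition at_succ (G : ctx) (p : form (N0 :: G)) : form (N0 :: G) :=
  ((fren (upr (r:=N0) shift) p)⟨Succ · #0⟩)%form.

(** * Derivability: classical natural deduction *)

(* A theory gives axioms in every context of free variables; an axiom with free
   variables amounts to its universal closure. *)
Definition theory := forall G : ctx, form G -> Prop.

Inductive prv (T : theory) : forall G : ctx, list (form G) -> form G -> Prop :=
| prv_ax G (A : list (form G)) p : T G p -> prv T A p
| prv_hyp G (A : list (form G)) p : In p A -> prv T A p
| prv_impI G (A : list (form G)) p q : prv T (p :: A) q -> prv T A (p ⟶ q)
| prv_impE G (A : list (form G)) p q : prv T A (p ⟶ q) -> prv T A p -> prv T A q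
| prv_raa G (A : list (form G)) p : prv T (Not p :: A) Bot -> prv T A p
| prv_andI G (A : list (form G)) p q : prv T A p -> prv T A q -> prv T A (p ⩓ q)
| prv_andE1 G (A : list (form G)) p q : prv T A (p ⩓ q) -> prv T A p
| prv_andE2 G (A : list (form G)) p q : prv T A (p ⩓ q) -> prv T A q
| prv_orI1 G (A : list (form G)) p q : prv T A p -> prv T A (p ⩔ q)
| prv_orI2 G (A : list (form G)) p q : prv T A q -> prv T A (p ⩔ q)
| prv_orE G (A : list (form G)) p q r :
    prv T A (p ⩔ q) -> prv T (p :: A) r -> prv T (q :: A) r -> prv T A r
| prv_allI G (A : list (form G)) s (p : form (s :: G)) :
    prv T (map (fren shift) A) p -> prv T A (∀ s, p)
| prv_allE G (A : list (form G)) s (p : form (s :: G)) (t : tm G s) :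
    prv T A (∀ s, p) -> prv T A p⟨t⟩
| prv_exI G (A : list (form G)) s (p : form (s :: G)) (t : tm G s) :
    prv T A p⟨t⟩ -> prv T A (∃ s, p)
| prv_exE G (A : list (form G)) s (p : form (s :: G)) r :
    prv T A (∃ s, p) ->
    prv T (p :: map (fren shift) A) (fren shift r) -> prv T A r.

Definition proves (T : theory) (p : form nil) : Prop := prv T nil p.
Notation "T '⊢' p" := (proves T p%form) (at level 95, no associativity).

(** * Arithmetic and finite sequences inside the system *)

Section ClosedTerms.
Context {G : ctx}.
Local Open Scope tm_scope.

Definition t_add : tm G (N0 ⇒ N0 ⇒ N0) :=
  λ N0, λ N0, Rec · #0 · #1 · (λ N0, λ N0, Succ · #1).

Definition t_pred : tm G (N0 ⇒ N0) :=
  λ N0, Rec · #0 · Zero · (λ N0, λ N0, #0).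

End ClosedTerms.

Definition t_monus {G : ctx} : tm G (N0 ⇒ N0 ⇒ N0) :=
  (λ N0, λ N0, Rec · #0 · #1 · (λ N0, λ N0, t_pred · #1))%tm.

Definition le0 {G : ctx} (m n : tm G N0) : form G :=
  (∃ N0, t_add · ↑m · #0 ≐ ↑n)%form.
Definition lt0 {G : ctx} (m n : tm G N0) : form G :=
  (∃ N0, t_add · ↑m · (Succ · #0) ≐ ↑n)%form.

(* The zero functional of each type, the default value of [t_nth]. *)
Fixpoint t_default {G : ctx} (s : ty) : tm G s :=
  match s with
  | N0 => Zero
  | Arr s r => Lam s (t_default r)
  | Seq s => Nil
  end.

Definition t_len {G : ctx} {s : ty} : tm G (s^* ⇒ N0) :=
  (λ s^*, LRec · #0 · Zero · (λ N0, λ s^*, λ s, Succ · #2))%tm.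

Definition t_nth {G : ctx} {s : ty} : tm G (s^* ⇒ N0 ⇒ s) :=
  (λ s^*, LRec · #0 · (λ N0, t_default s)
     · (λ N0 ⇒ s, λ s^*, λ s, λ N0, Rec · #0 · #1 · (λ s, λ N0, #5 · #0)))%tm.

Definition t_app {G : ctx} {s : ty} : tm G (s^* ⇒ s^* ⇒ s^*) :=
  (λ s^*, λ s^*, LRec · #1 · #0 · (λ s^*, λ s^*, λ s, Cons · #0 · #2))%tm.

(* The sequence <a 0, ..., a (n-1)>. *)
Definition t_init {G : ctx} {s : ty} : tm G ((N0 ⇒ s) ⇒ N0 ⇒ s^*) :=
  (λ N0 ⇒ s, λ N0,
     Rec · #0 · Nil · (λ s^*, λ N0, t_app · #1 · (Cons · (#3 · #0) · Nil)))%tm.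

Definition mem {G : ctx} {s : ty} (x : tm G s) (l : tm G s^*) : form G :=
  (∃ N0, lt0 #0 (t_len · ↑l) ⩓ ↑x ≐ t_nth · ↑l · #0)%form.

(** ** Coding finite sequences of numbers by numbers

    The code of the empty sequence is 0 and that of x :: l is
    2^x * (2 * code l + 1), so every number codes exactly one sequence. *)

Definition t_double {G : ctx} : tm G (N0 ⇒ N0) :=
  (λ N0, t_add · #0 · #0)%tm.

Definition t_enc {G : ctx} : tm G (N0^* ⇒ N0) :=
  (λ N0^*, LRec · #0 · Zero
     · (λ N0, λ N0^*, λ N0,
          Rec · #0 · (Succ · (t_double · #2)) · (λ N0, λ N0, t_double · #1)))%tm.

(* On decoded sequences: n |-> 2 * n, i.e. x :: l |-> (x + 1) :: l. *)
Definition t_seq_double {G : ctx} : tm G (N0^* ⇒ N0^*) :=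
  (λ N0^*, LRec · #0 · Nil · (λ N0^*, λ N0^*, λ N0, Cons · (Succ · #0) · #1))%tm.

(* On decoded sequences: n |-> n + 1, i.e. <> |-> <0>,
   (x + 1) :: l |-> 0 :: x :: l, and 0 :: l |-> double of (successor of l). *)
Definition t_seq_succ {G : ctx} : tm G (N0^* ⇒ N0^*) :=
  (λ N0^*, LRec · #0 · (Cons · Zero · Nil)
     · (λ N0^*, λ N0^*, λ N0,
          Rec · #0 · (t_seq_double · #2)
            · (λ N0^*, λ N0, Cons · Zero · (Cons · #0 · #3))))%tm.

Definition t_dec {G : ctx} : tm G (N0 ⇒ N0^*) :=
  (λ N0, Rec · #0 · Nil · (λ N0^*, λ N0, t_seq_succ · #1))%tm.

Section Codes.
Context {G : ctx}.

Definition c_len : tm G (N0 ⇒ N0) := (λ N0, t_len · (t_dec · #0))%tm.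
Definition c_nth : tm G (N0 ⇒ N0 ⇒ N0) := (λ N0, t_nth · (t_dec · #0))%tm.
Definition c_unit : tm G (N0 ⇒ N0) := (λ N0, t_enc · (Cons · #0 · Nil))%tm.
Definition c_cat : tm G (N0 ⇒ N0 ⇒ N0) :=
  (λ N0, λ N0, t_enc · (t_app · (t_dec · #1) · (t_dec · #0)))%tm.
Definition c_init : tm G (T1 ⇒ N0 ⇒ N0) :=
  (λ T1, λ N0, t_enc · (t_init · #1 · #0))%tm.
End Codes.

(* s * a for a coded sequence s and an infinite sequence a. *)
Definition c_catf {G : ctx} : tm G (N0 ⇒ T1 ⇒ T1) :=
  (λ N0, λ T1, λ N0,
     Rec · (t_monus · (c_len · #2) · #0)
       · (#1 · (t_monus · #0 · (c_len · #2)))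
       · (λ N0, λ N0, c_nth · #4 · #2))%tm.

Definition zeros {G : ctx} : tm G T1 := (λ N0, Zero)%tm.

(** ** The functionals H and G

    The defining recursions descend on M - |s|, which serves as the argument of
    the recursor; see [sem_fun_H] and [sem_fun_G] below. *)

Definition fun_H {G : ctx} : tm G (T2 ⇒ N0 ⇒ N0 ⇒ N0) :=
  (λ T2, λ N0, λ N0,                      (* Y, s, M *)
     Rec · (t_monus · #0 · (c_len · #1))
       · (λ N0,                           (* s' *)
            #3 · (c_catf · (c_init · (c_nth · #0) · #1) · zeros))
       · (λ T1, λ N0, λ N0,               (* h, k, s' *)
            #5 · (c_catf
              · (c_cat · (c_cat · #0 · (c_unit · Zero))
                  · (c_init · (λ N0, #3 · (c_cat · #1 · (c_unit · (Succ · #0)))) · #3))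
              · zeros))
       · #1)%tm.

Definition fun_G {G : ctx} : tm G (T2 ⇒ N0 ⇒ N0 ⇒ N0) :=
  (λ T2, λ N0, λ N0,                      (* Y, s, N *)
     Rec · (t_monus · #0 · (c_len · #1))
       · (λ N0, #3 · (c_catf · #0 · zeros)) (* s' *)
       · (λ T1, λ N0, λ N0,               (* h, k, s' *)
            #5 · (c_catf · (c_cat · #0 · (c_unit · Zero))
                   · (λ N0, #3 · (c_cat · #1 · (c_unit · (Succ · #0))))))
       · #1)%tm.

(** * Axioms *)

Local Open Scope form_scope.

(* Equality is primitive at every type, with extensionality as an axiom, and
   lambda-abstraction with beta replaces the combinators. Injectivity of [Cons]
   and induction on sequences follow from [LRec], [epa_seq] and [epa_ind]. *)
Inductive EPA : theory :=
| epa_refl G s (t : tm G s) : EPA (t ≐ t)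
| epa_leibniz G s (t u : tm G s) (p : form (s :: G)) :
    internal p -> EPA (t ≐ u ⟶ p⟨t⟩ ⟶ p⟨u⟩)
| epa_ext G s r (t u : tm G (s ⇒ r)) :
    EPA ((∀ s, ↑t · #0 ≐ ↑u · #0) ⟶ t ≐ u)
| epa_beta G s r (t : tm (s :: G) r) (u : tm G s) :
    EPA ((λ s, t) · u ≐ sub (inst u) t)
| epa_succ_neq0 G (t : tm G N0) : EPA (¬ (Succ · t ≐ Zero))
| epa_succ_inj G (t u : tm G N0) : EPA (Succ · t ≐ Succ · u ⟶ t ≐ u)
| epa_ind G (p : form (N0 :: G)) :
    internal p -> EPA (p⟨Zero⟩ ⩓ (∀ N0, p ⟶ at_succ p) ⟶ ∀ N0, p)
| epa_rec0 G s (a : tm G s) f : EPA (Rec · Zero · a · f ≐ a)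
| epa_recS G s (a : tm G s) f n :
    EPA (Rec · (Succ · n) · a · f ≐ f · (Rec · n · a · f) · n)
| epa_lrec0 G s r (a : tm G r) f : EPA (LRec · (Nil (s:=s)) · a · f ≐ a)
| epa_lrecS G s r (x : tm G s) l (a : tm G r) f :
    EPA (LRec · (Cons · x · l) · a · f ≐ f · (LRec · l · a · f) · l · x)
| epa_seq G s (l : tm G s^*) :
    EPA (l ≐ Nil ⩔ ∃ s, ∃ s^*, ↑↑l ≐ Cons · #1 · #0).

Inductive P : theory :=
| P_EPA G (p : form G) : EPA p -> P p
| P_st_eq G s (t u : tm G s) : P (St t ⩓ t ≐ u ⟶ St u)
| P_st_closed G s (t : tm nil s) : P (St (closed_tm (G:=G) t))
| P_st_app G s r (f : tm G (s ⇒ r)) (t : tm G s) : P (St f ⩓ St t ⟶ St (f · t))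
| P_st_ind G (p : form (N0 :: G)) :
    P (p⟨Zero⟩ ⩓ (∀st N0, p ⟶ at_succ p) ⟶ ∀st N0, p)
| P_HACint G s r (p : form (r :: s :: G)) : (* p(x, y) with x = #1, y = #0 *)
    internal p ->
    P ((∀st s, ∃st r, p) ⟶
       ∃st (s ⇒ r^*), ∀st s, ∃ r,
         mem #0 (#2 · #1) ⩓ fren (upr (r:=r) (upr (r:=s) shift)) p)
| P_ideal G s r (p : form (s :: r :: G)) : (* p(z, y) with z = #0, y = #1 *)
    internal p ->
    P ((∀st s^*, ∃ r, ∀ s,
         mem #0 #2 ⟶ fren (upr (r:=s) (upr (r:=r) shift)) p) ⟶
       ∃ r, ∀st s, p).

Definition infinite {G : ctx} (n : tm G N0) : form G := (¬ St n)%form.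

Definition approx1 {G : ctx} (f g : tm G T1) : form G :=
  (∀st N0, ↑f · #0 ≐ ↑g · #0)%form.

Definition binary {G : ctx} (f : tm G T1) : form G :=
  (∀ N0, le0 (↑f · #0) (Succ · Zero))%form.

Definition inC {G : ctx} (Y : tm G T2) : form G :=
  (∀ T1, ∃ N0, ∀ T1,                      (* f, N, g *)
     c_init · #0 · #1 ≐ c_init · #2 · #1 ⟶ ↑↑↑Y · #2 ≐ ↑↑↑Y · #0)%form.

Definition STP {G : ctx} : form G :=
  (∀ T1, binary #0 ⟶ ∃st T1, binary #0 ⩓ approx1 #1 #0)%form.

Definition NPC {G : ctx} : form G :=
  (∀st T2, inC #0 ⟶ ∀st T1, ∀ T1,         (* Y, f, g *)
     approx1 #1 #0 ⟶ #2 · #1 ≐ #2 · #0)%form.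

Inductive P_NPC_STP : theory :=
| PNS_P G (p : form G) : P p -> P_NPC_STP p
| PNS_NPC G : P_NPC_STP (NPC (G:=G))
| PNS_STP G : P_NPC_STP (STP (G:=G)).

Local Close Scope form_scope.

(** * The full set-theoretic model

    Used only to check that the closed terms above denote what they should. *)

Fixpoint sem (s : ty) : Type :=
  match s with
  | N0 => nat
  | Arr s r => sem s -> sem r
  | Seq s => list (sem s)
  end.

Definition env (G : ctx) := forall s, var G s -> sem s.

Definition env_nil : env nil := fun s x =>
  match x in var G' s' return match G' with nil => sem s' | _ :: _ => unit end
  with
  | vz => tt
  | vs _ => tt
  end.

Definition env_cons (G : ctx) (r : ty) (a : sem r) (e : env G) :
    env (r :: G) := fun s x =>
  match x in var G' s' return
    match G' with
    | nil => unit
    | r' :: G0 => sem r' -> (var G0 s' -> sem s') -> sem s'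
    end
  with
  | vz => fun a _ => a
  | vs y => fun _ g => g y
  end a (@e s).

Fixpoint eval (G : ctx) (s : ty) (t : tm G s) : env G -> sem s :=
  match t in tm _ s return env G -> sem s with
  | Var x => fun e => e _ x
  | App t u => fun e => eval t e (eval u e)
  | Lam r t => fun e a => eval t (env_cons a e)
  | Zero => fun _ => 0
  | Succ => fun _ => S
  | @Rec _ s => fun _ n a f => nat_rect (fun _ => sem s) a (fun k r => f r k) n
  | Nil => fun _ => nil
  | Cons => fun _ x l => x :: l
  | @LRec _ s r => fun _ l a f =>
      list_rect (fun _ => sem r) a (fun x l' y => f y l' x) l
  end.

Notation "⟦ t ⟧" := (eval (t : tm nil _) env_nil) (at level 0).

Lemma sem_add m n : ⟦t_add⟧ m n = m + n.
Proof. induction n; simpl in *; [lia | rewrite IHn; lia]. Qed.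

Lemma sem_monus m n : ⟦t_monus⟧ m n = m - n.
Proof.
  induction n; simpl in *; [lia | rewrite IHn].
  destruct (m - n) eqn:E; simpl; lia.
Qed.

Lemma sem_len s l : ⟦t_len (s:=s)⟧ l = length l.
Proof. induction l; simpl in *; congruence. Qed.

Lemma sem_nth s l i :
  ⟦t_nth (s:=s)⟧ l i = nth i l ⟦t_default s⟧.
Proof.
  assert (W : forall G D (e : env G) (e' : env D), eval (t_default s) e = eval (t_default s) e').
  { clear. induction s; simpl; intros; auto.
    apply functional_extensionality; auto. }
  set (aux := fun (d : nat -> sem s) (l : list (sem s)) =>
    list_rect (fun _ => nat -> sem s) d
      (fun x _ y i => nat_rect (fun _ => sem s) x (fun k _ => y k) i) l).
  transitivity (aux (fun _ => ⟦t_default s⟧) l i).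
  - transitivity (aux
      (fun j => eval (t_default s) (env_cons (r:=N0) j (env_cons (r:=s^*) l env_nil))) l i);
      [reflexivity |].
    f_equal. f_equal. apply functional_extensionality; intro; apply W.
  - revert i; induction l as [| x l IHl]; intros [| i]; try reflexivity.
    exact (IHl i).
Qed.

Lemma sem_app s l m : ⟦t_app (s:=s)⟧ l m = l ++ m.
Proof. induction l; simpl in *; congruence. Qed.

Lemma sem_init s a n : ⟦t_init (s:=s)⟧ a n = map a (seq 0 n).
Proof.
  induction n; [reflexivity |].
  rewrite seq_S, map_app, <- IHn, <- sem_app. reflexivity.
Qed.

Lemma sem_enc_cons (x : nat) (l : list nat) : ⟦t_enc⟧ (x :: l) = 2 ^ x * (2 * ⟦t_enc⟧ l + 1).
Proof.
  induction x.
  - change (⟦t_enc⟧ (0 :: l)) with (S (⟦t_add⟧ (⟦t_enc⟧ l) (⟦t_enc⟧ l))).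
    rewrite sem_add. simpl; lia.
  - change (⟦t_enc⟧ (S x :: l)) with (⟦t_add⟧ (⟦t_enc⟧ (x :: l)) (⟦t_enc⟧ (x :: l))).
    rewrite sem_add, IHx. simpl; lia.
Qed.

Lemma sem_dec_double n :
  ⟦t_dec⟧ (2 * n) = ⟦t_seq_double⟧ (⟦t_dec⟧ n) /\
  ⟦t_dec⟧ (2 * n + 1) = 0 :: ⟦t_dec⟧ n.
Proof.
  assert (E : forall m, ⟦t_dec⟧ (S m) = ⟦t_seq_succ⟧ (⟦t_dec⟧ m)) by reflexivity.
  assert (D : forall l, ⟦t_seq_succ⟧ (⟦t_seq_double⟧ l) = 0 :: l)
    by (intros []; reflexivity).
  assert (Z : forall l, ⟦t_seq_succ⟧ (0 :: l) = ⟦t_seq_double⟧ (⟦t_seq_succ⟧ l))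
    by reflexivity.
  assert (H : ⟦t_dec⟧ (2 * n) = ⟦t_seq_double⟧ (⟦t_dec⟧ n)).
  { induction n; [reflexivity |].
    replace (2 * S n) with (S (S (2 * n))) by lia.
    now rewrite !E, IHn, D, Z. }
  split; [exact H |].
  now rewrite Nat.add_1_r, E, H, D.
Qed.

Lemma sem_dec_enc (l : list nat) : ⟦t_dec⟧ (⟦t_enc⟧ l) = l.
Proof.
  induction l as [| x l IH]; [reflexivity |].
  rewrite sem_enc_cons. induction x as [| x IHx].
  - change (2 ^ 0) with 1. rewrite Nat.mul_1_l.
    now rewrite (proj2 (sem_dec_double _)), IH.
  - rewrite Nat.pow_succ_r', <- Nat.mul_assoc, (proj1 (sem_dec_double _)), IHx.
    reflexivity.
Qed.

Lemma sem_enc_dec n : ⟦t_enc⟧ (⟦t_dec⟧ n) = n.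
Proof.
  induction n as [n IH] using lt_wf_ind.
  destruct (Nat.Even_or_Odd n) as [[m ->] | [m ->]].
  - destruct m as [| m]; [reflexivity |].
    rewrite (proj1 (sem_dec_double _)).
    assert (Hm := IH (S m) ltac:(lia)).
    destruct (⟦t_dec⟧ (S m)) as [| x l]; [discriminate Hm |].
    change (⟦t_seq_double⟧ (x :: l)) with (S x :: l).
    rewrite sem_enc_cons in *. rewrite Nat.pow_succ_r'. lia.
  - rewrite (proj2 (sem_dec_double _)), sem_enc_cons, IH by lia. simpl; lia.
Qed.

Lemma sem_len_code (l : list nat) : ⟦c_len⟧ (⟦t_enc⟧ l) = length l.
Proof.
  transitivity (⟦t_len (s:=N0)⟧ (⟦t_dec⟧ (⟦t_enc⟧ l))); [reflexivity |].
  now rewrite sem_dec_enc, sem_len.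
Qed.

Lemma sem_nth_code (l : list nat) i : ⟦c_nth⟧ (⟦t_enc⟧ l) i = nth i l 0.
Proof.
  transitivity (⟦t_nth (s:=N0)⟧ (⟦t_dec⟧ (⟦t_enc⟧ l)) i); [reflexivity |].
  now rewrite sem_dec_enc, sem_nth.
Qed.

Lemma sem_cat_code (l m : list nat) : ⟦c_cat⟧ (⟦t_enc⟧ l) (⟦t_enc⟧ m) = ⟦t_enc⟧ (l ++ m).
Proof.
  transitivity (⟦t_enc⟧ (⟦t_app (s:=N0)⟧ (⟦t_dec⟧ (⟦t_enc⟧ l)) (⟦t_dec⟧ (⟦t_enc⟧ m))));
    [reflexivity |].
  now rewrite !sem_dec_enc, sem_app.
Qed.

Lemma sem_unit_code x : ⟦c_unit⟧ x = ⟦t_enc⟧ [x].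
Proof. reflexivity. Qed.

Lemma sem_init_code (a : nat -> nat) (n : nat) : ⟦c_init⟧ a n = ⟦t_enc⟧ (map a (seq 0 n)).
Proof.
  transitivity (⟦t_enc⟧ (⟦t_init (s:=N0)⟧ a n)); [reflexivity |].
  now rewrite sem_init.
Qed.

Lemma sem_catf_code (l : list nat) (a : nat -> nat) :
  ⟦c_catf⟧ (⟦t_enc⟧ l) a =
  fun i => if i <? length l then nth i l 0 else a (i - length l).
Proof.
  apply functional_extensionality; intro i.
  transitivity (nat_rect (fun _ => nat)
    (a (⟦t_monus⟧ i (⟦c_len⟧ (⟦t_enc⟧ l))))
    (fun _ _ => ⟦c_nth⟧ (⟦t_enc⟧ l) i)
    (⟦t_monus⟧ (⟦c_len⟧ (⟦t_enc⟧ l)) i)); [reflexivity |].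
  rewrite !sem_monus, sem_len_code, sem_nth_code.
  destruct (Nat.ltb_spec i (length l)).
  - destruct (length l - i) eqn:E; [lia | reflexivity].
  - replace (length l - i) with 0 by lia. reflexivity.
Qed.

Lemma sem_catf_zeros (l : list nat) :
  ⟦c_catf⟧ (⟦t_enc⟧ l) ⟦zeros⟧ = fun i => nth i l 0.
Proof.
  rewrite sem_catf_code. apply functional_extensionality; intro i.
  destruct (Nat.ltb_spec i (length l)); [reflexivity |].
  now rewrite nth_overflow.
Qed.

(* The defining equations of H, with explicit lists: the first branch is
   Y(the first M entries of l, then zeros), the second
   Y(l * 0 * H(Y, l*1, M) * ... * H(Y, l*M, M), then zeros). *)
Lemma sem_fun_H (Y : (nat -> nat) -> nat) (l : list nat) (M : nat) :
  ⟦fun_H⟧ Y (⟦t_enc⟧ l) M =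
  if M <=? length l then Y (fun i => nth i (firstn M l) 0)
  else Y (fun i => nth i
         (l ++ 0 :: map (fun n => ⟦fun_H⟧ Y (⟦t_enc⟧ (l ++ [n])) M) (seq 1 M)) 0).
Proof.
  set (base := fun s =>
    Y (⟦c_catf⟧ (⟦c_init⟧ (⟦c_nth⟧ s) M) ⟦zeros⟧)).
  set (step := fun (h : nat -> nat) (k s : nat) =>
    Y (⟦c_catf⟧ (⟦c_cat⟧ (⟦c_cat⟧ s (⟦c_unit⟧ 0))
         (⟦c_init⟧ (fun i => h (⟦c_cat⟧ s (⟦c_unit⟧ (S i)))) M)) ⟦zeros⟧)).
  set (h := fun k => nat_rect (fun _ => nat -> nat) base (fun k r => step r k) k).
  assert (HE : forall m, ⟦fun_H⟧ Y (⟦t_enc⟧ m) M = h (M - length m) (⟦t_enc⟧ m)).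
  { intro m. rewrite <- sem_len_code, <- sem_monus. reflexivity. }
  rewrite HE. destruct (Nat.leb_spec M (length l)) as [Hl | Hl].
  - replace (M - length l) with 0 by lia. change (h 0) with base. unfold base.
    rewrite sem_init_code, sem_catf_zeros. f_equal.
    apply functional_extensionality; intro i. f_equal.
    apply (nth_ext _ _ 0 0).
    + rewrite length_map, length_seq, length_firstn. lia.
    + intros n Hn. rewrite length_map, length_seq in Hn.
      rewrite (nth_indep _ 0 (⟦c_nth⟧ (⟦t_enc⟧ l) 0))
        by (rewrite length_map, length_seq; lia).
      rewrite map_nth, seq_nth, sem_nth_code by lia.
      rewrite <- (firstn_skipn M l) at 1. rewrite app_nth1; [reflexivity |].
      rewrite length_firstn. lia.
  - destruct (M - length l) as [| k] eqn:Hk; [lia |].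
    change (h (S k)) with (step (h k) k). unfold step.
    rewrite sem_unit_code, sem_cat_code, sem_init_code, sem_cat_code, sem_catf_zeros.
    f_equal. apply functional_extensionality; intro i. f_equal.
    rewrite <- app_assoc. cbn [app]. f_equal. f_equal.
    rewrite <- seq_shift, map_map. apply map_ext; intro n.
    rewrite sem_unit_code, sem_cat_code, HE, length_app.
    cbn [length]. f_equal. lia.
Qed.

Lemma sem_fun_G (Y : (nat -> nat) -> nat) (l : list nat) (N : nat) :
  ⟦fun_G⟧ Y (⟦t_enc⟧ l) N =
  if N <=? length l then Y (fun i => nth i l 0)
  else Y (fun i => if i <? length l then nth i l 0
                   else if i =? length l then 0
                   else ⟦fun_G⟧ Y (⟦t_enc⟧ (l ++ [i - length l])) N).
Proof.
  set (base := fun s => Y (⟦c_catf⟧ s ⟦zeros⟧)).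
  set (step := fun (h : nat -> nat) (k s : nat) =>
    Y (⟦c_catf⟧ (⟦c_cat⟧ s (⟦c_unit⟧ 0))
         (fun i => h (⟦c_cat⟧ s (⟦c_unit⟧ (S i)))))).
  set (h := fun k => nat_rect (fun _ => nat -> nat) base (fun k r => step r k) k).
  assert (HE : forall m, ⟦fun_G⟧ Y (⟦t_enc⟧ m) N = h (N - length m) (⟦t_enc⟧ m)).
  { intro m. rewrite <- sem_len_code, <- sem_monus. reflexivity. }
  rewrite HE. destruct (Nat.leb_spec N (length l)) as [Hl | Hl].
  - replace (N - length l) with 0 by lia. change (h 0) with base. unfold base.
    now rewrite sem_catf_zeros.
  - destruct (N - length l) as [| k] eqn:Hk; [lia |].
    change (h (S k)) with (step (h k) k). unfold step.
    rewrite sem_unit_code, sem_cat_code, sem_catf_code.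
    f_equal. apply functional_extensionality; intro i.
    rewrite length_app. simpl length.
    destruct (Nat.ltb_spec i (length l + 1)), (Nat.ltb_spec i (length l)); try lia.
    + now rewrite app_nth1.
    + replace i with (length l) by lia.
      now rewrite Nat.eqb_refl, nth_middle.
    + destruct (Nat.eqb_spec i (length l)); [lia |].
      rewrite sem_unit_code, sem_cat_code, HE, length_app. cbn [length].
      replace (S (i - (length l + 1))) with (i - length l) by lia.
      f_equal. lia.
Qed.

(* Main.v *)
(** Work in a model of P + NPC + STP, which is enough by completeness; call a
    number infinite if it is not standard.

    NPC yields transfer for standard [g] with [g n = 0] at all standard [n], by
    Grilliot's trick: HAC turns NPC into a standard functional that bounds the
    modulus of continuity at 0 of every standard [Y] in C, and if [g] had a first
    nonzero argument [n0], an infinite number, then this functional would produce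
    a standard continuous [Z] with [Z h] depending only on whether [h n0 = 0],
    against NPC at 0.

    With STP, transfer gives for every internal [F] a standard [b] such that, for
    standard [s], [F s] is standard only if [F s <= b s]. So for
    [F1 = H(Y, -, M)] and [F2 = H(Y, -, N)] (likewise for G) the condition
    "[F1 s = F2 s] and this value is standard" is internal on standard [s]. If it
    failed at a standard [s], then by NPC it would fail at some standard child
    [s * (n + 1)]. A bounded search therefore defines an internal path of failures
    that is standard at standard arguments, hence agrees there with a standard
    function; as [Y] has a standard modulus of continuity at that function, the
    failure stops at a standard node. *)

From Stdlib Require Import List Arith Lia Eqdep_dec Cantor.
From Stdlib Require Import Classical ClassicalEpsilon FunctionalExtensionality
  PropExtensionality ProofIrrelevance.
Require Import Defs.
Import ListNotations.

Set Implicit Arguments.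
Unset Strict Implicit.

(** * Substitution *)

(** Failure cannot be taken to mean just [F1 s <> F2 s]. If the standard children of [s] had equal
    but infinite values, the child function would have no standard part, and NPC would say nothing
    about [Y] there. So standardness of the value has to belong to the condition, and since
    recursion terms can only depend on internal data, the work on transfer and on [b] serves to
    express it internally. For the same reason the path of failures is a single term with an
    infinite search bound: children chosen one by one from outside would not form an element that
    could have a standard part. Only one fact about H and G enters: at a standard [s] the value is
    [Y] at some sequence agreeing, at standard arguments, with [s] followed by 0 and the values at
    the children. The cut-off at an infinite bound is invisible there, so one uniqueness argument
    covers both functionals. *)

Lemma var_cons_ind (r : ty) (G : ctx) (Q : forall s, var (r :: G) s -> Prop) :
  Q r vz -> (forall s (y : var G s), Q s (vs y)) -> forall s x, Q s x.
Proof.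
  intros H0 HS s x.
  (* The return type is computed from the context index and [Q] is generalized with it, so the case
     analysis needs no axiom on equality proofs. *)
  refine (match x as x' in var G' s' return
    (match G' return var G' s' -> Prop with
     | nil => fun _ => True
     | r' :: G0 => fun x => forall Q : forall s, var (r' :: G0) s -> Prop,
         Q r' vz -> (forall s y, Q s (vs y)) -> Q s' x
     end) x' with vz => _ | vs y => _ end Q H0 HS); auto.
Qed.

Lemma var_nil_elim (s : ty) (Q : var nil s -> Prop) (x : var nil s) : Q x.
Proof.
  refine (match x as x' in var G' s' return
    (match G' return var G' s' -> Prop with
     | nil => fun x => forall Q, Q x
     | _ :: _ => fun _ => True
     end) x' with vz => I | vs y => I end Q).
Qed.

Ltac var_ext :=
  apply functional_extensionality_dep; intro;
  apply functional_extensionality_dep;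
  match goal with |- forall x : var _ ?s, _ => revert s end;
  try apply var_cons_ind.

Lemma upr_upr (G D E : ctx) r (f : renaming G D) (g : renaming D E) :
  (fun s x => upr (r:=r) g (upr (r:=r) f x)) = upr (r:=r) (fun s x => g s (f s x)).
Proof. var_ext; reflexivity. Qed.

(** First of the four composition laws for renamings and substitutions. As [ups] renames the terms
    that it moves under a binder, [ren_sub] needs this law there, and [sub_sub] needs both mixed
    laws. *)
Lemma ren_ren (G : ctx) s (t : tm G s) : forall (D E : ctx) (f : renaming G D) (g : renaming D E),
  ren g (ren f t) = ren (fun s x => g s (f s x)) t.
Proof.
  induction t; intros; cbn; f_equal; auto.
  rewrite IHt. f_equal. apply upr_upr.
Qed.

Lemma ups_upr (G D E : ctx) r (f : renaming G D) (g : subst D E) :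
  (fun s x => ups (r:=r) g (upr (r:=r) f x)) = ups (r:=r) (fun s x => g s (f s x)).
Proof. var_ext; reflexivity. Qed.

Lemma sub_ren (G : ctx) s (t : tm G s) : forall (D E : ctx) (f : renaming G D) (g : subst D E),
  sub g (ren f t) = sub (fun s x => g s (f s x)) t.
Proof.
  induction t; intros; cbn; f_equal; auto.
  rewrite IHt. f_equal. apply ups_upr.
Qed.

Lemma upr_ups (G D E : ctx) r (f : subst G D) (g : renaming D E) :
  (fun s x => ren (upr (r:=r) g) (ups (r:=r) f x)) = ups (r:=r) (fun s x => ren g (f s x)).
Proof. var_ext; [reflexivity|]. intros s y. cbn. rewrite !ren_ren. reflexivity. Qed.

Lemma ren_sub (G : ctx) s (t : tm G s) : forall (D E : ctx) (f : subst G D) (g : renaming D E),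
  ren g (sub f t) = sub (fun s x => ren g (f s x)) t.
Proof.
  induction t; intros; cbn; f_equal; auto.
  rewrite IHt. f_equal. apply upr_ups.
Qed.

Lemma ups_ups (G D E : ctx) r (f : subst G D) (g : subst D E) :
  (fun s x => sub (ups (r:=r) g) (ups (r:=r) f x)) = ups (r:=r) (fun s x => sub g (f s x)).
Proof.
  var_ext; [reflexivity|]. intros s y. cbn. rewrite sub_ren, ren_sub. reflexivity.
Qed.

Lemma sub_sub (G : ctx) s (t : tm G s) : forall (D E : ctx) (f : subst G D) (g : subst D E),
  sub g (sub f t) = sub (fun s x => sub g (f s x)) t.
Proof.
  induction t; intros; cbn; f_equal; auto.
  rewrite IHt. f_equal. apply ups_ups.
Qed.

Lemma ups_ren (G D : ctx) r (f : renaming G D) :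
  ups (r:=r) (fun s x => Var (f s x)) = fun s x => Var (upr (r:=r) f x).
Proof. var_ext; reflexivity. Qed.

Lemma ren_as_sub (G : ctx) s (t : tm G s) : forall (D : ctx) (f : renaming G D),
  ren f t = sub (fun s x => Var (f s x)) t.
Proof.
  induction t; intros; cbn; f_equal; auto.
  rewrite IHt, ups_ren. reflexivity.
Qed.

Lemma ups_var (G : ctx) r :
  ups (r:=r) (fun s (x : var G s) => Var x) = fun s x => Var x.
Proof. var_ext; reflexivity. Qed.

Lemma sub_var (G : ctx) s (t : tm G s) : sub (fun s x => Var x) t = t.
Proof.
  induction t; cbn; f_equal; auto. rewrite ups_var. assumption.
Qed.

Lemma fren_as_fsub (G : ctx) (p : form G) : forall (D : ctx) (f : renaming G D),
  fren f p = fsub (fun s x => Var (f s x)) p.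
Proof.
  induction p; intros; cbn; rewrite ?ren_as_sub; f_equal; auto;
    rewrite IHp, ups_ren; reflexivity.
Qed.

Lemma fsub_fsub (G : ctx) (p : form G) : forall (D E : ctx) (f : subst G D) (g : subst D E),
  fsub g (fsub f p) = fsub (fun s x => sub g (f s x)) p.
Proof.
  induction p; intros; cbn; rewrite ?sub_sub; f_equal; auto;
    rewrite IHp, ups_ups; reflexivity.
Qed.

Lemma fsub_var (G : ctx) (p : form G) : fsub (fun s x => Var x) p = p.
Proof.
  induction p; cbn; rewrite ?sub_var; f_equal; auto;
    rewrite ups_var; assumption.
Qed.

Lemma internal_fsub (G : ctx) (p : form G) : forall (D : ctx) (f : subst G D),
  internal p -> internal (fsub f p).
Proof. induction p; cbn; intuition. Qed.

(** Extension of a substitution by one term, written as a composite so that instantiating below a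
    binder is a case of [fsub_fsub]. *)
Definition scons (G D : ctx) r (t : tm D r) (f : subst G D) : subst (r :: G) D :=
  fun s x => sub (inst t) (ups (r:=r) f x).

Lemma scons_vs (G D : ctx) r (t : tm D r) (f : subst G D) s (x : var G s) :
  scons t f (vs x) = f s x.
Proof. unfold scons. cbn. rewrite sub_ren. apply sub_var. Qed.

Lemma fsub_ups_inst (G D : ctx) r (f : subst G D) (p : form (r :: G)) (t : tm D r) :
  fsub (inst t) (fsub (ups (r:=r) f) p) = fsub (scons t f) p.
Proof. apply fsub_fsub. Qed.

Lemma scons_inst (G D : ctx) r (f : subst G D) (t : tm G r) :
  scons (sub f t) f = fun s x => sub f (inst t x).
Proof.
  var_ext; [reflexivity|]. intros s y. apply scons_vs.
Qed.

Lemma fsub_inst (G D : ctx) r (f : subst G D) (p : form (r :: G)) (t : tm G r) :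
  fsub f (fsub (inst t) p) = fsub (inst (sub f t)) (fsub (ups (r:=r) f) p).
Proof. rewrite fsub_ups_inst, fsub_fsub, scons_inst. reflexivity. Qed.

Lemma sub_inst (G D : ctx) r s (f : subst G D) (p : tm (r :: G) s) (t : tm G r) :
  sub f (sub (inst t) p) = sub (inst (sub f t)) (sub (ups (r:=r) f) p).
Proof. rewrite !sub_sub. f_equal. symmetry. apply scons_inst. Qed.

Lemma sub_ups_shift (G D : ctx) r s (f : subst G D) (t : tm G s) :
  sub (ups (r:=r) f) (ren shift t) = ren shift (sub f t).
Proof. rewrite sub_ren, ren_sub. reflexivity. Qed.

Lemma fsub_ups_shift (G D : ctx) r (f : subst G D) (p : form G) :
  fsub (ups (r:=r) f) (fren shift p) = fren shift (fsub f p).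
Proof.
  rewrite !fren_as_fsub, !fsub_fsub. f_equal. cbn.
  apply functional_extensionality_dep; intro s.
  apply functional_extensionality; intro x. rewrite <- ren_as_sub. reflexivity.
Qed.

(** What lets derivations move to larger contexts, and axioms be evaluated at arbitrary terms of the
    term model. *)
Definition subst_closed (T : theory) :=
  forall G D (f : subst G D) p, T G p -> T D (fsub f p).

Lemma sub_default (s : ty) : forall (G D : ctx) (f : subst G D),
  sub f (t_default s) = t_default s.
Proof. induction s; intros; cbn; f_equal; auto. Qed.

Lemma fsub_at_succ (G D : ctx) (f : subst G D) (p : form (N0 :: G)) :
  fsub (ups (r:=N0) f) (at_succ p) = at_succ (fsub (ups (r:=N0) f) p).
Proof.
  unfold at_succ. rewrite !fren_as_fsub, !fsub_fsub. f_equal. cbn.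
  var_ext; [reflexivity|]. intros s y. cbn.
  rewrite !sub_ren. cbn. rewrite ren_as_sub. reflexivity.
Qed.

Lemma EPA_subst_closed : subst_closed EPA.
Proof.
  intros G D f p H. revert D f. destruct H; intros D f'; cbn.
  - constructor.
  - rewrite !fsub_inst. constructor. now apply internal_fsub.
  - rewrite !sub_ups_shift. constructor.
  - rewrite sub_inst. constructor.
  - constructor.
  - constructor.
  - rewrite fsub_inst, fsub_at_succ. constructor. now apply internal_fsub.
  - constructor.
  - constructor.
  - constructor.
  - constructor.
  - rewrite !sub_ups_shift. constructor.
Qed.

Lemma fsub_upr_upr_shift (G D : ctx) (f : subst G D) q r s (p : form (r :: s :: G)) :
  fsub (ups (r:=r) (ups (r:=s) (ups (r:=q) f))) (fren (upr (r:=r) (upr (r:=s) shift)) p) =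
  fren (upr (r:=r) (upr (r:=s) shift)) (fsub (ups (r:=r) (ups (r:=s) f)) p).
Proof.
  rewrite !fren_as_fsub, !fsub_fsub. f_equal.
  var_ext; [reflexivity|]. apply var_cons_ind; [reflexivity|]. intros s' y. cbn.
  rewrite !sub_ren, <- !ren_as_sub, ?ren_ren. reflexivity.
Qed.

Lemma fsub_mem (s : ty) (G D : ctx) (f : subst G D) (x : tm G s) l :
  fsub f (mem x l) = mem (sub f x) (sub f l).
Proof.
  unfold mem, lt0, t_nth. cbn. rewrite !sub_default, !sub_ups_shift. reflexivity.
Qed.

Lemma P_subst_closed : subst_closed P.
Proof.
  intros G D f p H. revert D f. destruct H; intros D f'; cbn [fsub AllSt ExSt sub ups].
  - apply P_EPA. now apply EPA_subst_closed.
  - apply P_st_eq.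
  - replace (sub f' (closed_tm t)) with (closed_tm (G:=D) t); [apply P_st_closed|].
    unfold closed_tm. rewrite sub_ren, ren_as_sub. f_equal.
    apply functional_extensionality_dep; intro.
    apply functional_extensionality_dep; intro x'.
    exact (var_nil_elim (fun y => Var (from_nil y) = f' _ (from_nil y)) x').
  - apply P_st_app.
  - rewrite fsub_inst, fsub_at_succ. apply P_st_ind.
  - rewrite fsub_mem, fsub_upr_upr_shift. apply P_HACint. now apply internal_fsub.
  - rewrite fsub_mem, fsub_upr_upr_shift. apply P_ideal. now apply internal_fsub.
Qed.

Lemma P_NPC_STP_subst_closed : subst_closed P_NPC_STP.
Proof.
  intros G D f p H. revert D f. destruct H; intros D f'.
  - apply PNS_P. now apply P_subst_closed.
  - exact (PNS_NPC D).
  - exact (PNS_STP D).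
Qed.

(** * Derivability *)

Section Derivability.
Variable T : theory.

Lemma prv_weaken (G : ctx) (A : list (form G)) p :
  prv T A p -> forall B, incl A B -> prv T B p.
Proof.
  induction 1; intros B HB.
  - now apply prv_ax.
  - apply prv_hyp. auto.
  - apply prv_impI, IHprv. intros x [<-|Hx]; cbn; auto.
  - eapply prv_impE; eauto.
  - apply prv_raa, IHprv. intros x [<-|Hx]; cbn; auto.
  - apply prv_andI; auto.
  - eapply prv_andE1; eauto.
  - eapply prv_andE2; eauto.
  - apply prv_orI1; auto.
  - apply prv_orI2; auto.
  - eapply prv_orE; [eauto | apply IHprv2 | apply IHprv3];
      intros x [<-|Hx]; cbn; auto.
  - apply prv_allI, IHprv. now apply incl_map.
  - apply prv_allE; auto.
  - eapply prv_exI; eauto.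
  - eapply prv_exE; [eauto | apply IHprv2].
    intros x [<-|Hx]; [left; auto|]. right. now apply (incl_map _ HB).
Qed.

Hypothesis T_closed : subst_closed T.

Lemma map_fsub_ups_shift (G D : ctx) r (f : subst G D) A :
  map (fsub (ups (r:=r) f)) (map (fren shift) A) = map (fren shift) (map (fsub f) A).
Proof. rewrite !map_map. apply map_ext. intro. apply fsub_ups_shift. Qed.

Lemma prv_sub (G : ctx) (A : list (form G)) p :
  prv T A p -> forall D (f : subst G D), prv T (map (fsub f) A) (fsub f p).
Proof.
  induction 1; intros D f; cbn in *.
  - apply prv_ax. now apply T_closed.
  - apply prv_hyp. now apply in_map.
  - apply prv_impI, IHprv.
  - eapply prv_impE; [apply IHprv1 | apply IHprv2].
  - apply prv_raa, IHprv.
  - apply prv_andI; auto.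
  - eapply prv_andE1, IHprv.
  - eapply prv_andE2, IHprv.
  - apply prv_orI1; auto.
  - apply prv_orI2; auto.
  - eapply prv_orE; eauto.
  - apply prv_allI. rewrite <- map_fsub_ups_shift. apply IHprv.
  - rewrite fsub_inst. apply prv_allE. apply IHprv.
  - apply prv_exI with (t := sub f t). rewrite <- fsub_inst. apply IHprv.
  - eapply prv_exE; [apply IHprv1|].
    rewrite <- map_fsub_ups_shift, <- fsub_ups_shift. apply IHprv2.
Qed.

Lemma prv_ren (G D : ctx) (A : list (form G)) p (f : renaming G D) :
  prv T A p -> prv T (map (fren f) A) (fren f p).
Proof.
  intro H. rewrite fren_as_fsub.
  rewrite (map_ext _ (fsub (fun s x => Var (f s x)))) by (intro; apply fren_as_fsub).
  now apply prv_sub.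
Qed.

Lemma prv_exfalso (G : ctx) (A : list (form G)) p : prv T A Bot -> prv T A p.
Proof.
  intro H. apply prv_raa. eapply prv_weaken; [exact H|]. intros x; cbn; auto.
Qed.

Definition consistent (G : ctx) (A : list (form G)) := ~ prv T A Bot.

(** A fresh variable is harmless because every type has a closed term: a derivation of [Bot] is
    generalized and then instantiated with [t_default]. *)
Lemma consistent_shift (G : ctx) s (A : list (form G)) :
  consistent A -> consistent (map (fren (shift (r:=s))) A).
Proof.
  intros H K. apply H.
  exact (prv_allE (p := Bot) (t_default s) (prv_allI K)).
Qed.

Lemma consistent_decide (G : ctx) (A : list (form G)) p :
  consistent A -> ~ consistent (p :: A) -> consistent (Not p :: A).
Proof.
  intros H1 H2 H3. apply H1. apply NNPP in H2.
  eapply prv_impE; [|apply prv_raa; exact H3]. now apply prv_impI.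
Qed.

End Derivability.

(** * Countability of the syntax *)

Definition pair_code (a b : nat) : nat := Cantor.to_nat (a, b).

Arguments pair_code : simpl never.

Lemma pair_code_inj a b c d : pair_code a b = pair_code c d -> a = c /\ b = d.
Proof. unfold pair_code. intro H. apply Cantor.to_nat_inj in H. now injection H. Qed.

Ltac code_inv := repeat match goal with
  | H : pair_code _ _ = pair_code _ _ |- _ => apply pair_code_inj in H; destruct H
  end.

Fixpoint code_ty (s : ty) : nat :=
  match s with
  | N0 => pair_code 0 0
  | Arr s r => pair_code 1 (pair_code (code_ty s) (code_ty r))
  | Seq s => pair_code 2 (code_ty s)
  end.

Lemma code_ty_inj s : forall r, code_ty s = code_ty r -> s = r.
Proof.
  induction s; intros [] H; cbn in H; code_inv; try discriminate; f_equal; auto.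
Qed.

Lemma ty_eq_dec (s r : ty) : {s = r} + {s <> r}.
Proof. decide equality. Qed.

Fixpoint code_var (G : ctx) (s : ty) (x : var G s) : nat :=
  match x with vz => 0 | vs y => S (code_var y) end.

Lemma code_var_inj G s (x : var G s) : forall r (y : var G r),
  code_var x = code_var y -> existT (var G) s x = existT (var G) r y.
Proof.
  induction x as [G s | G s r x IH]; intros r' y;
    [ revert r' y; refine (var_cons_ind (Q := fun r' y => code_var (vz (G:=G) (s:=s)) = code_var y ->
        existT (var (s :: G)) s vz = existT _ r' y) _ _)
    | revert r' y; refine (var_cons_ind (Q := fun r' y => code_var (vs (r:=r) x) = code_var y ->
        existT (var (r :: G)) s (vs x) = existT _ r' y) _ _) ]; cbn.
  - reflexivity.
  - discriminate.
  - discriminate.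
  - intros s' y H. injection H as H. apply IH in H.
    exact (f_equal (fun z => existT (var (r :: G)) (projT1 z) (vs (projT2 z))) H).
Qed.

(** Neither the type of the term nor the argument type of an application is coded. The rest
    determines them, and injectivity is therefore stated for dependent pairs. *)
Fixpoint code_tm (G : ctx) (s : ty) (t : tm G s) : nat :=
  match t with
  | Var x => pair_code 0 (code_var x)
  | @App _ s r t u => pair_code 1 (pair_code (code_tm t) (code_tm u))
  | @Lam _ s r t => pair_code 2 (pair_code (code_ty s) (code_tm t))
  | Zero => pair_code 3 0
  | Succ => pair_code 4 0
  | @Rec _ s => pair_code 5 (code_ty s)
  | @Nil _ s => pair_code 6 (code_ty s)
  | @Cons _ s => pair_code 7 (code_ty s)
  | @LRec _ s r => pair_code 8 (pair_code (code_ty s) (code_ty r))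
  end.

Lemma existT_tm_inj G s r (t : tm G s) (u : tm G r) :
  existT (tm G) s t = existT (tm G) r u ->
  exists e : s = r, eq_rect s (tm G) t r e = u.
Proof. intro H. exists (projT1_eq H). exact (projT2_eq H). Qed.

Lemma code_tm_inj G s (t : tm G s) : forall r (u : tm G r),
  code_tm t = code_tm u -> existT (tm G) s t = existT (tm G) r u.
Proof.
  induction t; intros r' u H; destruct u; cbn in H; code_inv; try discriminate;
    repeat match goal with
    | H : code_ty _ = code_ty _ |- _ => apply code_ty_inj in H; subst
    end; try reflexivity.
  - apply code_var_inj in H0.
    exact (f_equal (fun z => existT (tm G) (projT1 z) (Var (projT2 z))) H0).
  - apply IHt1 in H0. apply IHt2 in H1.
    apply existT_tm_inj in H0, H1. destruct H0 as [e1 E1], H1 as [e2 E2].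
    (* The argument fixes [s], the equation between arrow types then fixes the result type, and
       decidable equality on [ty] removes the leftover transport. *)
    destruct e2. cbn in E2. subst t2.
    injection e1 as e3. destruct e3.
    rewrite <- (eq_rect_eq_dec ty_eq_dec) in E1. now subst.
  - apply IHt in H1.
    exact (f_equal (fun z => existT (tm G) (s0 ⇒ projT1 z)%ty (Lam s0 (projT2 z))) H1).
Qed.

(** For the two sides of an equation, whose common type has to be identified once for both. *)
Lemma code_tm_inj_pair G s (t t' : tm G s) r (u u' : tm G r) :
  code_tm t = code_tm u -> code_tm t' = code_tm u' ->
  existT (fun s => tm G s * tm G s)%type s (t, t') = existT _ r (u, u').
Proof.
  intros H1 H2. apply code_tm_inj, existT_tm_inj in H1, H2.
  destruct H1 as [e1 E1], H2 as [e2 E2]. destruct e1.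
  rewrite <- (eq_rect_eq_dec ty_eq_dec) in E1, E2. now subst.
Qed.

Fixpoint code_form (G : ctx) (p : form G) : nat :=
  match p with
  | Eq t u => pair_code 0 (pair_code (code_tm t) (code_tm u))
  | St t => pair_code 1 (code_tm t)
  | Bot => pair_code 2 0
  | Imp p q => pair_code 3 (pair_code (code_form p) (code_form q))
  | And p q => pair_code 4 (pair_code (code_form p) (code_form q))
  | Or p q => pair_code 5 (pair_code (code_form p) (code_form q))
  | All s p => pair_code 6 (pair_code (code_ty s) (code_form p))
  | Ex s p => pair_code 7 (pair_code (code_ty s) (code_form p))
  end.

Lemma code_form_inj G (p : form G) : forall q, code_form p = code_form q -> p = q.
Proof.
  induction p; intros q H; destruct q; cbn in H; code_inv; try discriminate;
    repeat match goal with
    | H : code_ty _ = code_ty _ |- _ => apply code_ty_inj in H; subst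
    end; f_equal; auto.
  - exact (f_equal (fun z => Eq (fst (projT2 z)) (snd (projT2 z))) (code_tm_inj_pair H0 H1)).
  - exact (f_equal (fun z => St (projT2 z)) (code_tm_inj H0)).
Qed.

Definition decode_ty (k : nat) : ty := epsilon (inhabits N0) (fun s => code_ty s = k).

Lemma decode_code_ty s : decode_ty (code_ty s) = s.
Proof.
  apply code_ty_inj. unfold decode_ty.
  apply (epsilon_spec (inhabits N0) (fun r => code_ty r = code_ty s)). now exists s.
Qed.

Definition decode_form (G : ctx) (k : nat) : form G :=
  epsilon (inhabits Bot) (fun p => code_form p = k).

Lemma decode_code_form G (p : form G) : decode_form G (code_form p) = p.
Proof.
  apply code_form_inj. unfold decode_form.
  apply (epsilon_spec (inhabits Bot) (fun q : form G => code_form q = code_form p)). now exists p.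
Qed.

(** * Structures *)

Record structure := {
  dom :> ty -> Type;
  point : forall s, dom s;
  app : forall s r, dom (s ⇒ r)%ty -> dom s -> dom r;
  d_zero : dom N0;
  d_succ : dom (N0 ⇒ N0)%ty;
  d_rec : forall s, dom (N0 ⇒ s ⇒ (s ⇒ N0 ⇒ s) ⇒ s)%ty;
  d_nil : forall s, dom (s^*)%ty;
  d_cons : forall s, dom (s ⇒ s^* ⇒ s^*)%ty;
  d_lrec : forall s r, dom (s^* ⇒ r ⇒ (r ⇒ s^* ⇒ s ⇒ r) ⇒ r)%ty;
  std : forall s, dom s -> Prop
}.

Definition val (M : structure) (G : ctx) := forall s, var G s -> M s.

Definition vnil (M : structure) : val M nil := fun s x =>
  match x in var G' s' return match G' with nil => M s' | _ :: _ => unit end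
  with
  | vz => tt
  | vs _ => tt
  end.
Arguments vnil {M}.

Definition vcons (M : structure) (G : ctx) (r : ty) (a : M r) (e : val M G) :
    val M (r :: G) := fun s x =>
  match x in var G' s' return
    match G' with
    | nil => unit
    | r' :: G0 => M r' -> (var G0 s' -> M s') -> M s'
    end
  with
  | vz => fun a _ => a
  | vs y => fun _ g => g y
  end a (@e s).

(* A function that no element of the structure represents has a junk
   abstraction; in a model of EPA every function defined by a term is
   represented, uniquely by extensionality. *)
Definition lam (M : structure) (s r : ty) (h : M s -> M r) : M (s ⇒ r)%ty :=
  epsilon (inhabits (point M _)) (fun f => forall a, app f a = h a).

Fixpoint den (M : structure) (G : ctx) (s : ty) (t : tm G s) : val M G -> M s :=
  match t in tm _ s return val M G -> M s with
  | Var x => fun e => e _ x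
  | App t u => fun e => app (den t e) (den u e)
  | Lam r t => fun e => lam (fun a => den t (vcons a e))
  | Zero => fun _ => d_zero M
  | Succ => fun _ => d_succ M
  | @Rec _ s => fun _ => d_rec M s
  | @Nil _ s => fun _ => d_nil M s
  | @Cons _ s => fun _ => d_cons M s
  | @LRec _ s r => fun _ => d_lrec M s r
  end.

Fixpoint holds (M : structure) (G : ctx) (p : form G) : val M G -> Prop :=
  match p with
  | Eq t u => fun e => den t e = den u e
  | St t => fun e => std (den t e)
  | Bot => fun _ => False
  | Imp p q => fun e => holds p e -> holds q e
  | And p q => fun e => holds p e /\ holds q e
  | Or p q => fun e => holds p e \/ holds q e
  | All s p => fun e => forall a : M s, holds p (vcons a e)
  | Ex s p => fun e => exists a : M s, holds p (vcons a e)
  end.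

Definition model (T : theory) (M : structure) :=
  forall G (p : form G), T G p -> forall e : val M G, holds p e.

Lemma vcons_upr (M : structure) (G D : ctx) r (f : renaming G D) (e : val M D) (a : M r) :
  (fun s x => vcons a e (upr (r:=r) f x)) = vcons a (fun s x => e s (f s x)).
Proof. var_ext; reflexivity. Qed.

Lemma den_ren (M : structure) G s (t : tm G s) : forall D (f : renaming G D) (e : val M D),
  den (ren f t) e = den t (fun s x => e s (f s x)).
Proof.
  induction t; intros D f e; cbn; auto; [now rewrite IHt1, IHt2|].
  f_equal. apply functional_extensionality; intro a. rewrite IHt, vcons_upr. reflexivity.
Qed.

Lemma vcons_ups (M : structure) (G D : ctx) r (f : subst G D) (e : val M D) (a : M r) :
  (fun s x => den (ups (r:=r) f x) (vcons a e)) = vcons a (fun s x => den (f s x) e).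
Proof. var_ext; [reflexivity|]. intros s y. cbn. rewrite den_ren. reflexivity. Qed.

Lemma den_sub (M : structure) G s (t : tm G s) : forall D (f : subst G D) (e : val M D),
  den (sub f t) e = den t (fun s x => den (f s x) e).
Proof.
  induction t; intros D f e; cbn; auto; [now rewrite IHt1, IHt2|].
  f_equal. apply functional_extensionality; intro a. rewrite IHt, vcons_ups. reflexivity.
Qed.

Lemma holds_fsub (M : structure) G (p : form G) : forall D (f : subst G D) (e : val M D),
  holds (fsub f p) e <-> holds p (fun s x => den (f s x) e).
Proof.
  induction p; intros D f e; cbn; rewrite ?den_sub; try tauto.
  - now rewrite IHp1, IHp2.
  - now rewrite IHp1, IHp2.
  - now rewrite IHp1, IHp2.
  - split; intros H a; specialize (H a); [rewrite IHp in H | rewrite IHp];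
      rewrite vcons_ups in *; exact H.
  - split; intros [a H]; exists a; [rewrite IHp in H | rewrite IHp];
      rewrite vcons_ups in *; exact H.
Qed.

Lemma holds_fren (M : structure) G (p : form G) D (f : renaming G D) (e : val M D) :
  holds (fren f p) e <-> holds p (fun s x => e s (f s x)).
Proof. rewrite fren_as_fsub. apply holds_fsub. Qed.

Lemma holds_inst (M : structure) G r (p : form (r :: G)) (t : tm G r) (e : val M G) :
  holds (fsub (inst t) p) e <-> holds p (vcons (den t e) e).
Proof.
  rewrite holds_fsub.
  replace (fun s x => den (inst t x) e) with (vcons (den t e) e); [tauto|].
  var_ext; reflexivity.
Qed.

(** * Completeness *)

Section Henkin.
Variable T : theory.
Hypothesis T_closed : subst_closed T.
Variable A0 : list (form nil).
Hypothesis A0_consistent : consistent T A0.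

(** * A complete Henkin extension of a consistent set *)

Definition h_ty (n : nat) : ty := decode_ty (fst (Cantor.of_nat n)).

(** Henkin constants are free variables, one more at each stage with the newest innermost, so the
    calculus itself need not be extended by constants. *)
Fixpoint h_ctx (n : nat) : ctx :=
  match n with 0 => nil | S n => h_ty n :: h_ctx n end.

(** Recursion on [m] with a test for [n = m], because a proof of [n <= m] cannot be eliminated into
    a renaming. *)
Fixpoint lift (n m : nat) {struct m} : n <= m -> renaming (h_ctx n) (h_ctx m) :=
  match Nat.eq_dec n m with
  | left e => fun _ => eq_rect n (fun k => renaming (h_ctx n) (h_ctx k)) (fun s x => x) m e
  | right ne =>
    match m return n <> m -> (n <= m -> renaming (h_ctx n) (h_ctx m)) with
    | 0 => fun ne h => False_rect _ (ne (proj1 (Nat.le_0_r n) h))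
    | S m' => fun ne h s x =>
        vs (lift (proj1 (Nat.lt_succ_r n m') (proj2 (Nat.le_neq n (S m')) (conj h ne))) x)
    end ne
  end.

Lemma lift_refl n (h : n <= n) : lift h = fun s x => x.
Proof.
  destruct n; cbn [lift]; destruct (Nat.eq_dec _ _) as [e|ne]; try congruence;
    rewrite (UIP_refl_nat _ e); reflexivity.
Qed.

Lemma lift_S n m (h : n <= m) (h' : n <= S m) : lift h' = fun s x => vs (lift h x).
Proof.
  cbn [lift]. destruct (Nat.eq_dec _ _) as [e|ne]; [lia|].
  match goal with |- context [lift ?a] => rewrite (proof_irrelevance _ a h) end. reflexivity.
Qed.

Lemma lift_lift n m p (h1 : n <= m) (h2 : m <= p) (h3 : n <= p) :
  (fun s x => lift h2 (lift h1 x)) = lift h3 (n:=n).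
Proof.
  induction p as [|p IH].
  - assert (m = 0) by lia. subst m. assert (n = 0) by lia. subst n.
    rewrite !lift_refl. reflexivity.
  - destruct (Nat.eq_dec m (S p)) as [->|ne].
    + rewrite (lift_refl h2). rewrite (proof_irrelevance _ h3 h1). reflexivity.
    + assert (k2 : m <= p) by lia. assert (k3 : n <= p) by lia.
      rewrite (lift_S k2), (lift_S k3), <- (IH k2 k3). reflexivity.
Qed.

Lemma fren_fren G D E (f : renaming G D) (g : renaming D E) p :
  fren g (fren f p) = fren (fun s x => g s (f s x)) p.
Proof. rewrite !fren_as_fsub, fsub_fsub. reflexivity. Qed.

Lemma fren_id G (p : form G) : fren (fun s x => x) p = p.
Proof. rewrite fren_as_fsub. apply fsub_var. Qed.

Lemma fren_lift_lift n m p (h1 : n <= m) (h2 : m <= p) (h3 : n <= p) q :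
  fren (lift h2) (fren (lift h1) q) = fren (lift h3) q.
Proof. rewrite fren_fren. f_equal. apply lift_lift. Qed.

Lemma ren_lift_lift n m p (h1 : n <= m) (h2 : m <= p) (h3 : n <= p) s (t : tm (h_ctx n) s) :
  ren (lift h2) (ren (lift h1) t) = ren (lift h3) t.
Proof. rewrite ren_ren. f_equal. apply lift_lift. Qed.

(* At stage [n], the formula with its innermost variable read as the newest
   Henkin constant. *)
Definition request (n : nat) : form (h_ctx (S n)) :=
  let (i, j) := Cantor.of_nat (snd (Cantor.of_nat n)) in
  match le_dec i n with
  | left h => fren (upr (r:=h_ty n) (lift h)) (decode_form (h_ty n :: h_ctx i) j)
  | right _ => Bot
  end.

(** The stage [n] codes [s], [i] and [p] together. A pair code is at least as large as its
    components, hence [i <= n] and the parameters of [p] already exist. *)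
Lemma request_surj i s (p : form (s :: h_ctx i)) :
  exists n (h : i <= n) (e : s = h_ty n),
    request n = fren (upr (r:=h_ty n) (lift h))
                  (eq_rect s (fun s => form (s :: h_ctx i)) p _ e).
Proof.
  set (k := Cantor.to_nat (i, code_form p)).
  set (n := Cantor.to_nat (code_ty s, k)).
  assert (h : i <= n).
  { pose proof (Cantor.to_nat_non_decreasing i (code_form p)).
    pose proof (Cantor.to_nat_non_decreasing (code_ty s) k). unfold n, k in *. lia. }
  assert (e : s = h_ty n).
  { unfold h_ty, n. rewrite Cantor.cancel_of_to. symmetry. apply decode_code_ty. }
  assert (E : Cantor.of_nat (snd (Cantor.of_nat n)) = (i, code_form p)).
  { unfold n. rewrite Cantor.cancel_of_to. apply Cantor.cancel_of_to. }
  exists n, h, e. unfold request. rewrite E.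
  destruct (le_dec i n) as [h'|]; [|contradiction].
  rewrite (proof_irrelevance _ h' h). f_equal.
  clear E; clearbody n. destruct e. apply decode_code_form.
Qed.

(** One kind of step does two jobs. A request that mentions the new constant supplies a witness
    whenever the existential formula holds; a request that does not mention it decides a formula of
    the earlier stage. *)
Fixpoint hyps (n : nat) : list (form (h_ctx n)) :=
  match n with
  | 0 => A0
  | S n =>
    let B := map (fren shift) (hyps n) in
    if excluded_middle_informative (consistent T (request n :: B))
    then request n :: B else Not (request n) :: B
  end.

Lemma hyps_consistent n : consistent T (hyps n).
Proof.
  induction n as [|n IH]; [exact A0_consistent|]. cbn [hyps].
  destruct excluded_middle_informative as [H|H]; [exact H|].
  apply consistent_decide; [now apply consistent_shift | exact H].
Qed.

Lemma hyps_lift n m (h : n <= m) p : prv T (hyps n) p -> prv T (hyps m) (fren (lift h) p).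
Proof.
  intro H. revert h. induction m as [|m IH]; intro h.
  - assert (n = 0) by lia. subst n. now rewrite lift_refl, fren_id.
  - destruct (Nat.eq_dec n (S m)) as [->|ne]; [now rewrite lift_refl, fren_id|].
    assert (k : n <= m) by lia.
    rewrite (lift_S k).
    change (prv T (hyps (S m)) (fren (fun s x => shift (r:=h_ty m) (lift k x)) p)).
    rewrite <- (fren_fren (lift k) (shift (r:=h_ty m))).
    eapply prv_weaken; [apply (prv_ren T_closed shift (IH k))|].
    cbn. intros x Hx. destruct excluded_middle_informative; now right.
Qed.

Definition Tr n (p : form (h_ctx n)) :=
  exists m (h : n <= m), prv T (hyps m) (fren (lift h) p).

Lemma Tr_lift n m (h : n <= m) p : Tr (fren (lift h) p) <-> Tr p.
Proof.
  split; intros (k & hk & H).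
  - assert (h' : n <= k) by lia. exists k, h'. now rewrite (fren_lift_lift _ _ h') in H.
  - assert (hk' : k <= m + k) by lia. assert (hm : m <= m + k) by lia.
    exists (m + k), hm. apply (hyps_lift hk') in H.
    rewrite (fren_lift_lift _ _ (Nat.le_trans _ _ _ hk hk')) in H.
    rewrite (fren_lift_lift _ _ (Nat.le_trans _ _ _ h hm)).
    now rewrite (proof_irrelevance _ (Nat.le_trans n m (m + k) h hm) (Nat.le_trans n k (m + k) hk hk')).
Qed.

Lemma Tr_prv n p : prv T nil p -> Tr (n:=n) p.
Proof.
  intro H. exists n, (le_n n). rewrite lift_refl, fren_id.
  eapply prv_weaken; [exact H|]. intros x [].
Qed.

Lemma Tr_mp n p q : Tr (n:=n) (p ⟶ q)%form -> Tr p -> Tr q.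
Proof.
  intros (k & hk & H) (m & hm & K).
  assert (h1 : k <= k + m) by lia. assert (h2 : m <= k + m) by lia.
  assert (h3 : n <= k + m) by lia.
  apply (hyps_lift h1) in H. apply (hyps_lift h2) in K.
  rewrite (fren_lift_lift _ _ h3) in H. rewrite (fren_lift_lift _ _ h3) in K.
  exists (k + m), h3. eapply prv_impE; [exact H | exact K].
Qed.

Lemma Tr_ded n L : forall p, prv T L p -> (forall q, In q L -> Tr (n:=n) q) -> Tr p.
Proof.
  induction L as [|q L IH]; intros p H HL.
  - now apply Tr_prv.
  - apply Tr_mp with q; [|apply HL; now left].
    apply IH; [now apply prv_impI | intros; apply HL; now right].
Qed.

Lemma Tr_bot n : ~ Tr (n:=n) Bot.
Proof. intros (m & h & H). now apply (hyps_consistent (n:=m)). Qed.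

(** In the second case the refutation uses only hypotheses without the new constant, so it can be
    generalized over that constant. *)
Lemma request_dec n : Tr (request n) \/
  prv T (map (fren shift) (hyps n)) (Not (request n)).
Proof.
  destruct (excluded_middle_informative (consistent T (request n :: map (fren shift) (hyps n))))
    as [H|H] eqn:E.
  - left. exists (S n), (le_n _). rewrite lift_refl, fren_id. apply prv_hyp.
    cbn [hyps]. rewrite E. now left.
  - right. clear E. apply NNPP in H. now apply prv_impI.
Qed.

Lemma fren_upr_shift G D r (f : renaming G D) p :
  fren (upr (r:=r) f) (fren shift p) = fren shift (fren f p).
Proof. rewrite !fren_fren. reflexivity. Qed.

Lemma Tr_dec n p : Tr (n:=n) p \/ Tr (Not p).
Proof.
  (* A dummy innermost variable makes [p] a possible request. *)
  destruct (request_surj (fren (shift (r:=N0)) p)) as (m & h & e & E).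
  assert (E' : request m = fren shift (fren (lift h) p)).
  { rewrite E. rewrite <- fren_upr_shift. f_equal. clear E. now destruct e. }
  assert (h' : n <= S m) by lia.
  destruct (request_dec m) as [H|H]; rewrite E' in H; rewrite fren_fren in H; [left|right];
    rewrite <- (Tr_lift h'), (lift_S h).
  - exact H.
  - exists (S m), (le_n _). rewrite lift_refl, fren_id.
    eapply prv_weaken; [exact H|].
    cbn. intros x Hx. destruct excluded_middle_informative; now right.
Qed.

Lemma Tr_imp n p q : Tr (n:=n) (p ⟶ q)%form <-> (Tr p -> Tr q).
Proof.
  split; [apply Tr_mp|]. intro H.
  destruct (Tr_dec p) as [Hp|Hp].
  - apply (Tr_ded (L := [q])); [|intros ? [<-|[]]; auto].
    apply prv_impI, prv_hyp. cbn; auto.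
  - apply (Tr_ded (L := [Not p])); [|intros ? [<-|[]]; auto].
    apply prv_impI, prv_exfalso. eapply prv_impE; apply prv_hyp; cbn; [right; left; reflexivity | auto].
Qed.

Lemma Tr_not n p : Tr (n:=n) (Not p) <-> ~ Tr p.
Proof.
  unfold Not. rewrite Tr_imp. split; intros H K; [apply (@Tr_bot n)|]; tauto.
Qed.

Lemma Tr_and n p q : Tr (n:=n) (p ⩓ q)%form <-> Tr p /\ Tr q.
Proof.
  split.
  - intro H. split; (apply (Tr_ded (L := [(p ⩓ q)%form])); [|intros ? [<-|[]]; auto]).
    + eapply prv_andE1, prv_hyp; cbn; eauto.
    + eapply prv_andE2, prv_hyp; cbn; eauto.
  - intros [Hp Hq]. apply (Tr_ded (L := [p; q])); [|intros ? [<-|[<-|[]]]; auto].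
    apply prv_andI; apply prv_hyp; cbn; auto.
Qed.

Lemma Tr_or n p q : Tr (n:=n) (p ⩔ q)%form <-> Tr p \/ Tr q.
Proof.
  split.
  - intro H. apply NNPP. intro K. apply not_or_and in K. destruct K as [Kp Kq].
    rewrite <- Tr_not in Kp, Kq. apply (@Tr_bot n).
    apply (Tr_ded (L := [(p ⩔ q)%form; Not p; Not q])); [|intros ? [<-|[<-|[<-|[]]]]; auto].
    eapply prv_orE; [apply prv_hyp; cbn; eauto | |];
      (eapply prv_impE; apply prv_hyp; [|cbn; left; reflexivity]; cbn; tauto).
  - intros [H|H].
    + apply (Tr_ded (L := [p])); [|intros ? [<-|[]]; auto].
      apply prv_orI1, prv_hyp; cbn; auto.
    + apply (Tr_ded (L := [q])); [|intros ? [<-|[]]; auto].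
      apply prv_orI2, prv_hyp; cbn; auto.
Qed.

Lemma fren_upr_inst_var G r (p : form (r :: G)) :
  fsub (inst (Var vz)) (fren (upr (r:=r) shift) p) = p.
Proof.
  rewrite fren_as_fsub, fsub_fsub. etransitivity; [|apply fsub_var]. f_equal.
  var_ext; reflexivity.
Qed.

Lemma prv_ex_all_not G s (q : form (s :: G)) : prv T [∃ s, q; ∀ s, Not q]%form Bot.
Proof.
  apply prv_exE with (p := q); [apply prv_hyp; now left|].
  apply prv_impE with q; [|apply prv_hyp; now left].
  match goal with |- prv T ?B _ => set (C := B) end.
  pose proof (fren_upr_inst_var (Not q)) as E. cbn [fren]. change (q ⟶ Bot)%form with (Not q). rewrite <- E.
  apply prv_allE, prv_hyp. right; right; now left.
Qed.

(** The witness is the constant of the stage that requests [p]: had that request been refused,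
    generalization would make [∀ s, Not p] true. *)
Lemma Tr_ex n s p : Tr (n:=n) (∃ s, p)%form <->
  exists m (h : n <= m) (t : tm (h_ctx m) s),
    Tr (fsub (inst t) (fren (upr (r:=s) (lift h)) p)).
Proof.
  split.
  - intro H. destruct (request_surj p) as (m & h & e & E).
    subst s. cbn [eq_rect] in E.
    assert (h' : n <= S m) by lia.
    assert (E' : fsub (inst (Var vz)) (fren (upr (r:=h_ty m) (lift h')) p) = request m).
    { rewrite E, <- (fren_upr_inst_var (fren (upr (r:=h_ty m) (lift h)) p)) at 1.
      now rewrite fren_fren, upr_upr, (lift_S h). }
    destruct (request_dec m) as [K|K].
    + exists (S m), h', (Var vz).
      exact (eq_ind_r (fun q => Tr (n:=S m) q) K E').
    + exfalso. rewrite E in K. apply prv_allI in K.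
      rewrite <- (Tr_lift h) in H. apply (@Tr_bot m).
      assert (K' : Tr (∀ h_ty m, Not (fren (upr (r:=h_ty m) (lift h)) p))%form).
      { exists m, (le_n m). rewrite lift_refl, fren_id. exact K. }
      eapply Tr_ded with (L := [_; _]);
        [|intros q [<-|[<-|[]]]; [exact H | exact K']].
      apply prv_ex_all_not.
  - intros (m & h & t & H). rewrite <- (Tr_lift h).
    apply (Tr_ded (L := [fsub (inst t) (fren (upr (r:=s) (lift h)) p)])); [|intros ? [<-|[]]; auto].
    cbn. apply prv_exI with t. apply prv_hyp; cbn; auto.
Qed.

Lemma Tr_all n s p : Tr (n:=n) (∀ s, p)%form <->
  forall m (h : n <= m) (t : tm (h_ctx m) s),
    Tr (fsub (inst t) (fren (upr (r:=s) (lift h)) p)).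
Proof.
  split.
  - intros H m h t. rewrite <- (Tr_lift h) in H.
    eapply Tr_ded with (L := [_]); [|intros ? [<-|[]]; exact H].
    apply prv_allE, prv_hyp. cbn; auto.
  - intro H. apply NNPP. intro K. rewrite <- Tr_not in K.
    assert (E : Tr (∃ s, Not p)%form).
    { eapply Tr_ded with (L := [_]); [|intros ? [<-|[]]; exact K].
      apply prv_raa. eapply prv_impE; [apply prv_hyp; right; left; reflexivity|].
      apply prv_allI. apply prv_raa.
      eapply prv_impE; [apply prv_hyp; right; left; reflexivity|].
      cbn [fren]. apply prv_exI with (Var vz). cbn [fsub fren Not].
      rewrite fren_upr_inst_var. apply prv_hyp; left; reflexivity. }
    apply Tr_ex in E. destruct E as (m & h & t & E).
    apply (proj1 (Tr_not _) E). apply H.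
Qed.

(** * The term model *)

Hypothesis T_EPA : forall G (p : form G), EPA p -> T p.
Hypothesis T_st : forall G s (t u : tm G s), T (St t ⩓ t ≐ u ⟶ St u)%form.

Lemma Tr_refl n s (t : tm (h_ctx n) s) : Tr (t ≐ t)%form.
Proof. apply Tr_prv, prv_ax, T_EPA. constructor. Qed.

Lemma Tr_leibniz n s (t u : tm (h_ctx n) s) p : internal p ->
  Tr (t ≐ u)%form -> Tr (fsub (inst t) p) -> Tr (fsub (inst u) p).
Proof.
  intros Hp H1 H2. eapply Tr_mp; [|exact H2]. eapply Tr_mp; [|exact H1].
  apply Tr_prv, prv_ax, T_EPA. now constructor.
Qed.

Lemma sub_inst_shift G r s (t : tm G s) (u : tm G r) : sub (inst u) (ren shift t) = t.
Proof. rewrite sub_ren. apply sub_var. Qed.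

Lemma Tr_sym n s (t u : tm (h_ctx n) s) : Tr (t ≐ u)%form -> Tr (u ≐ t)%form.
Proof.
  intro H. pose proof (Tr_leibniz (p := Eq (Var vz) (ren shift t)) I H) as K.
  cbn in K. rewrite !sub_inst_shift in K. apply K, Tr_refl.
Qed.

Lemma Tr_trans n s (t u v : tm (h_ctx n) s) :
  Tr (t ≐ u)%form -> Tr (u ≐ v)%form -> Tr (t ≐ v)%form.
Proof.
  intros H1 H2. pose proof (Tr_leibniz (p := Eq (ren shift t) (Var vz)) I H2) as K.
  cbn in K. rewrite !sub_inst_shift in K. now apply K.
Qed.

Lemma Tr_app n s r (t t' : tm (h_ctx n) (s ⇒ r)) (u u' : tm (h_ctx n) s) :
  Tr (t ≐ t')%form -> Tr (u ≐ u')%form -> Tr (t · u ≐ t' · u')%form.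
Proof.
  intros H1 H2. apply Tr_trans with (App t' u).
  - pose proof (Tr_leibniz (p := Eq (ren shift (App t u)) (App (Var vz) (ren shift u))) I H1) as K.
    cbn in K. rewrite !sub_inst_shift in K. apply K, Tr_refl.
  - pose proof (Tr_leibniz (p := Eq (ren shift (App t' u)) (App (ren shift t') (Var vz))) I H2) as K.
    cbn in K. rewrite !sub_inst_shift in K. apply K, Tr_refl.
Qed.

Definition cls s n (t : tm (h_ctx n) s) : forall m, tm (h_ctx m) s -> Prop :=
  fun m u => exists p (h1 : n <= p) (h2 : m <= p), Tr (ren (lift h1) t ≐ ren (lift h2) u)%form.

(** The quotient by provable equality, as a set of classes that range over the terms of all stages.
    Functional and propositional extensionality turn true equations into genuine equality, which is
    how [holds] reads [Eq]. *)
Definition h_dom (s : ty) : Type :=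
  { c : forall m, tm (h_ctx m) s -> Prop | exists n (t : tm (h_ctx n) s), c = cls t }.

Definition mk s n (t : tm (h_ctx n) s) : h_dom s :=
  exist _ (cls t) (ex_intro _ n (ex_intro _ t eq_refl)).

Lemma h_dom_ind s (Q : h_dom s -> Prop) : (forall n t, Q (mk (n:=n) t)) -> forall d, Q d.
Proof.
  intros H [c Hc]. pose proof Hc as (n & t & ->).
  rewrite (subset_eq_compat _ _ (cls t) (cls t) Hc (ex_intro _ n (ex_intro _ t eq_refl)) eq_refl).
  apply H.
Qed.

Lemma Tr_eq_lift n m (h : n <= m) s (t u : tm (h_ctx n) s) :
  Tr (ren (lift h) t ≐ ren (lift h) u)%form <-> Tr (t ≐ u)%form.
Proof. exact (Tr_lift h (t ≐ u)%form). Qed.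

Lemma cls_change s n m (t : tm (h_ctx n) s) (u : tm (h_ctx m) s) p (h1 : n <= p) (h2 : m <= p) :
  cls t u -> Tr (ren (lift h1) t ≐ ren (lift h2) u)%form.
Proof.
  intros (q & k1 & k2 & H).
  assert (kp : p <= p + q) by lia. assert (kq : q <= p + q) by lia.
  rewrite <- (Tr_eq_lift kq) in H. rewrite <- (Tr_eq_lift kp).
  rewrite (ren_lift_lift _ _ (Nat.le_trans _ _ _ h1 kp)).
  rewrite (ren_lift_lift _ _ (Nat.le_trans _ _ _ h2 kp)).
  rewrite (ren_lift_lift _ _ (Nat.le_trans _ _ _ h1 kp)) in H.
  rewrite (ren_lift_lift _ _ (Nat.le_trans _ _ _ h2 kp)) in H. exact H.
Qed.

Lemma mk_eq_iff s n m (t : tm (h_ctx n) s) (u : tm (h_ctx m) s) p (h1 : n <= p) (h2 : m <= p) :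
  mk t = mk u <-> Tr (ren (lift h1) t ≐ ren (lift h2) u)%form.
Proof.
  split; intro H.
  - apply (f_equal (@proj1_sig _ _)) in H. cbn in H. apply cls_change.
    rewrite H. exists m, (le_n _), (le_n _). apply Tr_refl.
  - unfold mk. apply subset_eq_compat.
    do 2 (apply functional_extensionality_dep; intro). rename x into k, x0 into v.
    apply propositional_extensionality.
    assert (e1 : n <= p + k) by lia. assert (e2 : m <= p + k) by lia.
    assert (e3 : k <= p + k) by lia. assert (e4 : p <= p + k) by lia.
    rewrite <- (Tr_eq_lift e4) in H.
    rewrite (ren_lift_lift _ _ e1), (ren_lift_lift _ _ e2) in H.
    split; intro K; exists (p + k).
    + exists e2, e3. eapply Tr_trans; [apply Tr_sym, H|]. now apply cls_change.
    + exists e1, e3. eapply Tr_trans; [apply H|]. now apply cls_change.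
Qed.

Lemma mk_eq s n (t u : tm (h_ctx n) s) : mk t = mk u <-> Tr (t ≐ u)%form.
Proof.
  rewrite (mk_eq_iff t u (le_n n) (le_n n)). apply Tr_eq_lift.
Qed.

Lemma mk_lift s n m (h : n <= m) (t : tm (h_ctx n) s) : mk (ren (lift h) t) = mk t.
Proof.
  rewrite (mk_eq_iff _ _ (le_n m) h), (ren_lift_lift _ _ h). apply Tr_refl.
Qed.

(** Any two representatives can be lifted to a common stage; [Tr_app] makes the result independent
    of their choice. *)
Definition h_app s r (d : h_dom (s ⇒ r)) (e : h_dom s) : h_dom r :=
  epsilon (inhabits (mk (n:=0) (t_default r))) (fun x =>
    exists n (t : tm (h_ctx n) (s ⇒ r)) (u : tm (h_ctx n) s),
      d = mk t /\ e = mk u /\ x = mk (App t u)).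

Lemma h_app_mk s r n (t : tm (h_ctx n) (s ⇒ r)) (u : tm (h_ctx n) s) :
  h_app (mk t) (mk u) = mk (App t u).
Proof.
  unfold h_app. match goal with |- epsilon ?i ?Q = _ =>
    assert (H : Q (epsilon i Q)) end.
  { apply epsilon_spec. exists (mk (App t u)), n, t, u. auto. }
  destruct H as (m & t' & u' & H1 & H2 & ->).
  assert (h1 : n <= n + m) by lia. assert (h2 : m <= n + m) by lia.
  symmetry. rewrite (mk_eq_iff _ _ h1 h2).
  apply Tr_app; apply mk_eq_iff; assumption.
Qed.

Definition h_std s (d : h_dom s) : Prop :=
  exists n (t : tm (h_ctx n) s), d = mk t /\ Tr (St t).

(** The Leibniz axiom covers internal formulas only, so standardness respects equality by its own
    axiom [T_st]. *)
Lemma h_std_mk s n (t : tm (h_ctx n) s) : h_std (mk t) <-> Tr (St t).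
Proof.
  split.
  - intros (m & u & H & K).
    assert (h1 : n <= n + m) by lia. assert (h2 : m <= n + m) by lia.
    rewrite (mk_eq_iff _ _ h1 h2) in H. rewrite <- (Tr_lift h1). rewrite <- (Tr_lift h2) in K.
    eapply Tr_mp; [apply Tr_prv, prv_ax, T_st|]. apply Tr_and. split; [exact K|].
    now apply Tr_sym.
  - intro H. exists n, t. auto.
Qed.

Definition henkin : structure := {|
  dom := h_dom;
  point := fun s => mk (n:=0) (t_default s);
  app := h_app;
  d_zero := mk (n:=0) Zero;
  d_succ := mk (n:=0) Succ;
  d_rec := fun s => mk (n:=0) Rec;
  d_nil := fun s => mk (n:=0) Nil;
  d_cons := fun s => mk (n:=0) Cons;
  d_lrec := fun s r => mk (n:=0) LRec;
  std := h_std
|}.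

Definition mks G n (f : subst G (h_ctx n)) : val henkin G := fun s x => mk (f s x).

Lemma vcons_mks G n r (f : subst G (h_ctx n)) (t : tm (h_ctx n) r) :
  vcons (M:=henkin) (mk t) (mks f) = mks (scons t f).
Proof.
  var_ext; [reflexivity|]. intros s y. cbn. unfold mks. now rewrite scons_vs.
Qed.

Lemma mks_lift G n m (h : n <= m) (f : subst G (h_ctx n)) :
  mks (fun s x => ren (lift h) (f s x)) = mks f.
Proof.
  apply functional_extensionality_dep; intro s.
  apply functional_extensionality_dep; intro x. apply mk_lift.
Qed.

Lemma vcons_mks_lift G n r (f : subst G (h_ctx n)) (a : henkin r) :
  exists m (h : n <= m) (t : tm (h_ctx m) r), a = mk t /\
    vcons (M:=henkin) a (mks f) = mks (scons t (fun s x => ren (lift h) (f s x))).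
Proof.
  revert a. apply h_dom_ind. intros m t.
  assert (h1 : n <= n + m) by lia. assert (h2 : m <= n + m) by lia.
  exists (n + m), h1, (ren (lift h2) t). rewrite <- (mks_lift h1 f), <- (mk_lift h2 t).
  split; [reflexivity|]. apply vcons_mks.
Qed.

Lemma henkin_ext s r (f g : henkin (s ⇒ r)%ty) : (forall a, app f a = app g a) -> f = g.
Proof.
  revert f. apply (h_dom_ind (Q := fun f => (forall a, h_app f a = h_app g a) -> f = g)).
  revert g. apply (h_dom_ind (Q := fun g => forall n t, (forall a, h_app (mk t) a = h_app g a) -> mk (n:=n) t = g)).
  intros n t m u H.
  assert (h1 : m <= n + m) by lia. assert (h2 : n <= n + m) by lia.
  rewrite <- (mk_lift h1 u), <- (mk_lift h2 t) in *.
  rewrite mk_eq. eapply Tr_mp; [apply Tr_prv, prv_ax, T_EPA, epa_ext|].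
  apply Tr_all. intros k h v. specialize (H (mk v)).
  rewrite <- (mk_lift h (ren (lift h1) u)), <- (mk_lift h (ren (lift h2) t)), !h_app_mk, mk_eq in H.
  cbn. rewrite !ren_ren, !sub_ren in *. cbn. rewrite !ren_as_sub in H. exact H.
Qed.

Lemma den_mks G s (t : tm G s) : forall n (f : subst G (h_ctx n)),
  den t (mks f) = mk (sub f t).
Proof.
  induction t; intros n f; cbn;
    try (match goal with |- mk ?c = _ => exact (eq_sym (mk_lift (Nat.le_0_l n) c)) end).
  - reflexivity.
  - rewrite IHt1, IHt2. apply h_app_mk.
  - apply henkin_ext. intro a.
    (* The class of the abstraction itself represents the function, by the beta axiom. So the choice
       inside [lam] has a candidate, and extensionality identifies the chosen element with it. *)
    assert (B : forall a, app (s := s) (r := r) (s0 := henkin) (mk (Lam s (sub (ups (r:=s) f) t))) a =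
      den t (vcons a (mks f))).
    { clear a. intro a. destruct (vcons_mks_lift f a) as (m & h & u & -> & ->).
      rewrite IHt. rewrite <- (mk_lift h). cbn. rewrite h_app_mk, mk_eq.
      rewrite ren_sub, upr_ups.
      unfold scons. rewrite <- sub_sub.
      apply Tr_prv, prv_ax, T_EPA, epa_beta. }
    rewrite B. unfold lam. revert a.
    match goal with |- forall a, app (epsilon ?i ?Q) a = _ => change (Q (epsilon i Q)) end.
    apply epsilon_spec. eexists. exact B.
Qed.

Lemma fsub_scons_lift G n m (h : n <= m) r (f : subst G (h_ctx n)) (t : tm (h_ctx m) r) p :
  fsub (inst t) (fren (upr (r:=r) (lift h)) (fsub (ups (r:=r) f) p)) =
  fsub (scons t (fun s x => ren (lift h) (f s x))) p.
Proof.
  rewrite <- fsub_ups_inst. f_equal. rewrite fren_as_fsub, fsub_fsub. f_equal.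
  rewrite <- upr_ups. apply functional_extensionality_dep; intro s.
  apply functional_extensionality_dep; intro x. symmetry. apply ren_as_sub.
Qed.

Lemma holds_mks G (p : form G) : forall n (f : subst G (h_ctx n)),
  holds p (mks f) <-> Tr (fsub f p).
Proof.
  induction p; intros n f; cbn [holds fsub].
  - rewrite !den_mks. apply mk_eq.
  - rewrite !den_mks. apply h_std_mk.
  - split; [tauto | apply Tr_bot].
  - now rewrite Tr_imp, IHp1, IHp2.
  - now rewrite Tr_and, IHp1, IHp2.
  - now rewrite Tr_or, IHp1, IHp2.
  - rewrite Tr_all. split.
    + intros H m h t. rewrite fsub_scons_lift, <- IHp, <- vcons_mks, mks_lift. apply H.
    + intros H a. destruct (vcons_mks_lift f a) as (m & h & t & _ & ->).
      rewrite IHp, <- fsub_scons_lift. apply H.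
  - rewrite Tr_ex. split.
    + intros [a H]. destruct (vcons_mks_lift f a) as (m & h & t & _ & E).
      rewrite E in H. exists m, h, t. now rewrite fsub_scons_lift, <- IHp.
    + intros (m & h & t & H). exists (mk t).
      rewrite fsub_scons_lift, <- IHp, <- vcons_mks, mks_lift in H. exact H.
Qed.

(** A context is finite, so all values of [e] are named at one common stage. *)
Lemma val_as_mks G (e : val henkin G) : exists n (f : subst G (h_ctx n)), e = mks f.
Proof.
  induction G as [|r G IH].
  - exists 0, (fun s x => Var x). apply functional_extensionality_dep; intro s.
    apply functional_extensionality_dep; intro x. exact (var_nil_elim (fun y => e s y = mk (n:=0) (Var y)) x).
  - destruct (IH (fun s x => e s (vs x))) as (n & f & E).
    destruct (vcons_mks_lift f (e r vz)) as (m & h & t & _ & E').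
    rewrite <- E in E'. eexists m, _. rewrite <- E'. var_ext; reflexivity.
Qed.

Lemma henkin_model : model T henkin.
Proof.
  intros G p H e. destruct (val_as_mks e) as (n & f & ->).
  apply holds_mks, Tr_prv, prv_ax. now apply T_closed.
Qed.

Lemma henkin_hyps p : In p A0 -> holds (M:=henkin) p vnil.
Proof.
  intro H. destruct (val_as_mks vnil) as (n & f & ->). apply holds_mks.
  assert (h : 0 <= n) by lia.
  replace (fsub f p) with (fren (lift h) p).
  - apply Tr_lift. exists 0, (le_n 0). rewrite lift_refl, fren_id. now apply prv_hyp.
  - rewrite fren_as_fsub. f_equal. apply functional_extensionality_dep; intro s.
    apply functional_extensionality_dep; intro x.
    exact (var_nil_elim (fun y => Var (lift h y) = f s y) x).
Qed.

End Henkin.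

Theorem completeness (T : theory) (p : form nil) :
  subst_closed T ->
  (forall G (p : form G), EPA p -> T G p) ->
  (forall G s (t u : tm G s), T G (St t ⩓ t ≐ u ⟶ St u)%form) ->
  (forall M, model T M -> holds (M:=M) p vnil) -> T ⊢ p.
Proof.
  intros HT HE HS H. apply prv_raa. apply NNPP. intro K.
  apply (henkin_hyps HT K HE HS (or_introl eq_refl)).
  apply H. now apply henkin_model.
Qed.

(** * Arithmetic in a model *)

Definition t_sum {G : ctx} : tm G (T1 ⇒ N0 ⇒ N0) :=
  (λ T1, λ N0, Rec · #0 · Zero · (λ N0, λ N0, t_add · #1 · (#3 · #0)))%tm.

Definition t_lsum {G : ctx} : tm G (N0^* ⇒ N0) :=
  (λ N0^*, LRec · #0 · Zero · (λ N0, λ N0^*, λ N0, t_add · #2 · #0))%tm.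

Definition t_ifz {G : ctx} : tm G (N0 ⇒ N0 ⇒ N0 ⇒ N0) :=
  (λ N0, λ N0, λ N0, Rec · #2 · #1 · (λ N0, λ N0, #2))%tm.

(* The least [i <= n] with [f i <> 0], or [n] if there is none. *)
Definition t_search {G : ctx} : tm G (T1 ⇒ N0 ⇒ N0) :=
  (λ T1, λ N0, Rec · #0 · Zero · (λ N0, λ N0, t_ifz · (#3 · #1) · (Succ · #1) · #1))%tm.

Definition t_pair {G : ctx} : tm G (N0 ⇒ N0 ⇒ N0) :=
  (λ N0, λ N0, t_enc · (Cons · #1 · (Cons · #0 · Nil)))%tm.

(* The code of [s * (n + 1)]. *)
Definition t_snoc {G : ctx} : tm G (N0 ⇒ N0 ⇒ N0) :=
  (λ N0, λ N0, c_cat · #1 · (c_unit · (Succ · #0)))%tm.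

Section Model.
Variable M : structure.
Hypothesis HM : model P_NPC_STP M.

Local Notation "f ∙ x" := (app f x) (at level 11, left associativity).
Local Notation num := (dom M N0).
Local Notation O := (d_zero M).
Local Notation S' x := (d_succ M ∙ x).

Lemma HP G (p : form G) : P p -> forall e : val M G, holds p e.
Proof. intros H e. apply HM. now constructor. Qed.

Lemma HEPA G (p : form G) : EPA p -> forall e : val M G, holds p e.
Proof. intros H e. apply HP. now constructor. Qed.

(** The axiom speaks of terms, while [a] need not be denoted by one over [G]. It is therefore
    applied in the context with one more variable, whose value is [a]. *)
Lemma beta G s r (t : tm (s :: G) r) (e : val M G) (a : M s) :
  den (Lam s t) e ∙ a = den t (vcons a e).
Proof.
  pose proof (HEPA (epa_beta (ren (upr (r:=s) shift) t) (Var vz)) (vcons a e)) as H.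
  cbn [holds] in H. rewrite den_sub, den_ren in H.
  transitivity (den (App (Lam s (ren (upr (r:=s) shift) t)) (Var vz)) (vcons a e)).
  - cbn. f_equal. f_equal. apply functional_extensionality; intro b.
    rewrite den_ren, vcons_upr. reflexivity.
  - rewrite H. f_equal. var_ext; reflexivity.
Qed.

Lemma den_App G s r (t : tm G (s ⇒ r)) u (e : val M G) : den (App t u) e = den t e ∙ den u e.
Proof. reflexivity. Qed.
Lemma den_vz G s (e : val M G) (a : M s) : den (Var vz) (vcons a e) = a.
Proof. reflexivity. Qed.
Lemma den_vs G s r (e : val M G) (a : M s) (x : var G r) :
  den (Var (vs x)) (vcons a e) = den (Var x) e.
Proof. reflexivity. Qed.
Lemma den_Zero G (e : val M G) : den Zero e = O.
Proof. reflexivity. Qed.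
Lemma den_Succ G (e : val M G) : den Succ e = d_succ M.
Proof. reflexivity. Qed.
Lemma den_Rec G s (e : val M G) : den (Rec (s:=s)) e = d_rec M s.
Proof. reflexivity. Qed.
Lemma den_Nil G s (e : val M G) : den (Nil (s:=s)) e = d_nil M s.
Proof. reflexivity. Qed.
Lemma den_Cons G s (e : val M G) : den (Cons (s:=s)) e = d_cons M s.
Proof. reflexivity. Qed.
Lemma den_LRec G s r (e : val M G) : den (LRec (s:=s) (r:=r)) e = d_lrec M s r.
Proof. reflexivity. Qed.
Lemma den_shift G s r (t : tm G s) (e : val M G) (a : M r) :
  den (ren shift t) (vcons a e) = den t e.
Proof. apply den_ren. Qed.

Lemma ext s r (f g : M (s ⇒ r)%ty) : (forall a, f ∙ a = g ∙ a) -> f = g.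
Proof.
  exact (HEPA (epa_ext (G := [s ⇒ r; s ⇒ r]%ty) (Var vz) (Var (vs vz)))
    (vcons f (vcons g vnil))).
Qed.

Lemma rec_0 s (a : M s) f : d_rec M s ∙ O ∙ a ∙ f = a.
Proof.
  exact (HEPA (epa_rec0 (G := [s; _]%ty) (Var vz) (Var (vs vz))) (vcons a (vcons f vnil))).
Qed.

Lemma rec_S s (a : M s) f n : d_rec M s ∙ (S' n) ∙ a ∙ f = f ∙ (d_rec M s ∙ n ∙ a ∙ f) ∙ n.
Proof.
  exact (HEPA (epa_recS (G := [s; _; N0]%ty) (Var vz) (Var (vs vz)) (Var (vs (vs vz))))
    (vcons a (vcons f (vcons n vnil)))).
Qed.

Lemma lrec_nil s r (a : M r) f : d_lrec M s r ∙ (d_nil M s) ∙ a ∙ f = a.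
Proof.
  exact (HEPA (epa_lrec0 (G := [r; _]%ty) (Var vz) (Var (vs vz))) (vcons a (vcons f vnil))).
Qed.

Lemma lrec_cons s r (x : M s) l (a : M r) f :
  d_lrec M s r ∙ (d_cons M s ∙ x ∙ l) ∙ a ∙ f = f ∙ (d_lrec M s r ∙ l ∙ a ∙ f) ∙ l ∙ x.
Proof.
  exact (HEPA (epa_lrecS (G := [r; _; s; _]%ty) (Var (vs (vs vz))) (Var (vs (vs (vs vz))))
    (Var vz) (Var (vs vz)))
    (vcons a (vcons f (vcons x (vcons l vnil))))).
Qed.

Definition ADD : M (N0 ⇒ N0 ⇒ N0)%ty := den t_add vnil.
Definition PRED : M (N0 ⇒ N0)%ty := den t_pred vnil.
Definition MONUS : M (N0 ⇒ N0 ⇒ N0)%ty := den t_monus vnil.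
Definition SUM : M (T1 ⇒ N0 ⇒ N0)%ty := den t_sum vnil.
Definition IFZ : M (N0 ⇒ N0 ⇒ N0 ⇒ N0)%ty := den t_ifz vnil.
Definition SEARCH : M (T1 ⇒ N0 ⇒ N0)%ty := den t_search vnil.
Definition LEN : M (N0^* ⇒ N0)%ty := den t_len vnil.
Definition NTH : M (N0^* ⇒ N0 ⇒ N0)%ty := den t_nth vnil.
Definition APP : M (N0^* ⇒ N0^* ⇒ N0^*)%ty := den t_app vnil.
Definition INIT : M ((N0 ⇒ N0) ⇒ N0 ⇒ N0^*)%ty := den t_init vnil.
Definition LSUM : M (N0^* ⇒ N0)%ty := den t_lsum vnil.
Definition DOUBLE : M (N0 ⇒ N0)%ty := den t_double vnil.
Definition ENC : M (N0^* ⇒ N0)%ty := den t_enc vnil.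
Definition SDOUBLE : M (N0^* ⇒ N0^*)%ty := den t_seq_double vnil.
Definition SSUCC : M (N0^* ⇒ N0^*)%ty := den t_seq_succ vnil.
Definition DEC : M (N0 ⇒ N0^*)%ty := den t_dec vnil.
Definition PAIR : M (N0 ⇒ N0 ⇒ N0)%ty := den t_pair vnil.
Definition SNOC : M (N0 ⇒ N0 ⇒ N0)%ty := den t_snoc vnil.
Definition CLEN : M (N0 ⇒ N0)%ty := den c_len vnil.
Definition CNTH : M (N0 ⇒ N0 ⇒ N0)%ty := den c_nth vnil.
Definition CUNIT : M (N0 ⇒ N0)%ty := den c_unit vnil.
Definition CCAT : M (N0 ⇒ N0 ⇒ N0)%ty := den c_cat vnil.
Definition CINIT : M (T1 ⇒ N0 ⇒ N0)%ty := den c_init vnil.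
Definition CATF : M (N0 ⇒ T1 ⇒ T1)%ty := den c_catf vnil.
Definition ZEROS : M T1 := den zeros vnil.

(** These hold by conversion: evaluating a closed term looks up bound variables only and never
    reaches [e]. Together with opacity they make [ev] stop at named functions. *)
Lemma den_add G (e : val M G) : den t_add e = ADD. Proof. reflexivity. Qed.
Lemma den_pred G (e : val M G) : den t_pred e = PRED. Proof. reflexivity. Qed.
Lemma den_monus G (e : val M G) : den t_monus e = MONUS. Proof. reflexivity. Qed.
Lemma den_sum G (e : val M G) : den t_sum e = SUM. Proof. reflexivity. Qed.
Lemma den_ifz G (e : val M G) : den t_ifz e = IFZ. Proof. reflexivity. Qed.
Lemma den_search G (e : val M G) : den t_search e = SEARCH. Proof. reflexivity. Qed.
Lemma den_len G (e : val M G) : den t_len e = LEN. Proof. reflexivity. Qed.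
Lemma den_nth G (e : val M G) : den t_nth e = NTH. Proof. reflexivity. Qed.
Lemma den_tapp G (e : val M G) : den t_app e = APP. Proof. reflexivity. Qed.
Lemma den_init G (e : val M G) : den t_init e = INIT. Proof. reflexivity. Qed.
Lemma den_lsum G (e : val M G) : den t_lsum e = LSUM. Proof. reflexivity. Qed.
Lemma den_double G (e : val M G) : den t_double e = DOUBLE. Proof. reflexivity. Qed.
Lemma den_enc G (e : val M G) : den t_enc e = ENC. Proof. reflexivity. Qed.
Lemma den_sdouble G (e : val M G) : den t_seq_double e = SDOUBLE. Proof. reflexivity. Qed.
Lemma den_ssucc G (e : val M G) : den t_seq_succ e = SSUCC. Proof. reflexivity. Qed.
Lemma den_dec G (e : val M G) : den t_dec e = DEC. Proof. reflexivity. Qed.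
Lemma den_pair G (e : val M G) : den t_pair e = PAIR. Proof. reflexivity. Qed.
Lemma den_snoc G (e : val M G) : den t_snoc e = SNOC. Proof. reflexivity. Qed.
Lemma den_clen G (e : val M G) : den c_len e = CLEN. Proof. reflexivity. Qed.
Lemma den_cnth G (e : val M G) : den c_nth e = CNTH. Proof. reflexivity. Qed.
Lemma den_cunit G (e : val M G) : den c_unit e = CUNIT. Proof. reflexivity. Qed.
Lemma den_ccat G (e : val M G) : den c_cat e = CCAT. Proof. reflexivity. Qed.
Lemma den_cinit G (e : val M G) : den c_init e = CINIT. Proof. reflexivity. Qed.
Lemma den_catf G (e : val M G) : den c_catf e = CATF. Proof. reflexivity. Qed.
Lemma den_zeros G (e : val M G) : den zeros e = ZEROS. Proof. reflexivity. Qed.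

Local Opaque t_add t_pred t_monus t_sum t_ifz t_search t_len t_nth t_app t_init t_lsum
  t_double t_enc t_seq_double t_seq_succ t_dec t_pair t_snoc
  c_len c_nth c_unit c_cat c_init c_catf zeros.

Ltac ev1 := rewrite
  ?beta, ?den_App, ?den_vz, ?den_vs, ?den_Zero, ?den_Succ, ?den_Rec, ?den_Nil, ?den_Cons,
  ?den_LRec, ?den_shift, ?beta,
  ?den_add, ?den_pred, ?den_monus, ?den_sum, ?den_ifz, ?den_search, ?den_len, ?den_nth,
  ?den_tapp, ?den_init, ?den_lsum, ?den_double, ?den_enc, ?den_sdouble, ?den_ssucc, ?den_dec,
  ?den_pair, ?den_snoc, ?den_clen, ?den_cnth, ?den_cunit, ?den_ccat, ?den_cinit, ?den_catf,
  ?den_zeros.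
Ltac ev := repeat (progress ev1).
Ltac evin H := revert H; ev; intro H.

Lemma add_0_r x : ADD ∙ x ∙ O = x.
Proof. unfold ADD. with_strategy transparent [t_add] unfold t_add. ev. apply rec_0. Qed.

Lemma add_S_r x y : ADD ∙ x ∙ (S' y) = S' (ADD ∙ x ∙ y).
Proof. unfold ADD. with_strategy transparent [t_add] unfold t_add. ev. rewrite rec_S. ev. reflexivity. Qed.

Lemma pred_0 : PRED ∙ O = O.
Proof. unfold PRED. with_strategy transparent [t_pred] unfold t_pred. ev. apply rec_0. Qed.

Lemma pred_S x : PRED ∙ (S' x) = x.
Proof. unfold PRED. with_strategy transparent [t_pred] unfold t_pred. ev. rewrite rec_S. ev. reflexivity. Qed.

Lemma monus_0_r x : MONUS ∙ x ∙ O = x.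
Proof. unfold MONUS. with_strategy transparent [t_monus] unfold t_monus. ev. apply rec_0. Qed.

Lemma monus_S_r x y : MONUS ∙ x ∙ (S' y) = PRED ∙ (MONUS ∙ x ∙ y).
Proof. unfold MONUS. with_strategy transparent [t_monus] unfold t_monus. ev. rewrite rec_S. ev. reflexivity. Qed.


Definition le (x y : num) := exists z, ADD ∙ x ∙ z = y.
(** An instance of [le], so that the lemmas on [le] apply. The formula [lt0] has the successor on
    the other summand, which [HAC_bound] has to convert. *)
Definition lt (x y : num) := le (S' x) y.

(** Induction in the model covers only predicates given by an internal formula. Each induction below
    therefore displays its formula, and [change] or [ev] translates between the formula and its
    meaning. *)
Lemma int_ind G (p : form (N0 :: G)) (e : val M G) : internal p ->
  holds p (vcons O e) ->
  (forall n, holds p (vcons n e) -> holds p (vcons (S' n) e)) ->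
  forall n, holds p (vcons n e).
Proof.
  intros Hp H0 HS. apply (HEPA (epa_ind Hp) e). split; [now apply holds_inst|].
  intros n Hn. unfold at_succ. apply holds_inst, holds_fren. rewrite vcons_upr.
  exact (HS n Hn).
Qed.

Lemma st_ind G (p : form (N0 :: G)) (e : val M G) :
  holds p (vcons O e) ->
  (forall n, std n -> holds p (vcons n e) -> holds p (vcons (S' n) e)) ->
  forall n, std n -> holds p (vcons n e).
Proof.
  intros H0 HS. apply (HP (P_st_ind p) e). split; [now apply holds_inst|].
  intros n Hst Hn. unfold at_succ. apply holds_inst, holds_fren. rewrite vcons_upr.
  exact (HS n Hst Hn).
Qed.

Lemma S_neq_0 n : S' n <> O.
Proof. exact (HEPA (epa_succ_neq0 (G := [N0]) (Var vz)) (vcons n vnil)). Qed.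

Lemma S_inj m n : S' m = S' n -> m = n.
Proof.
  exact (HEPA (epa_succ_inj (G := [N0; N0]) (Var vz) (Var (vs vz))) (vcons m (vcons n vnil))).
Qed.

Lemma num_cases n : n = O \/ exists m, n = S' m.
Proof.
  revert n. refine (int_ind (p := (#0 ≐ Zero ⩔ ∃ N0, #1 ≐ Succ · #0)%form) (e := vnil) _ _ _);
    cbn; [tauto | now left | intros n _; right; now exists n].
Qed.

Lemma add_0_l n : ADD ∙ O ∙ n = n.
Proof.
  revert n. refine (int_ind (p := (t_add · Zero · #0 ≐ #0)%form) (e := vnil) I _ _);
    cbn [holds]; ev; [apply add_0_r|]. intros n H. evin H. ev. now rewrite add_S_r, H.
Qed.

Lemma add_S_l m n : ADD ∙ (S' m) ∙ n = S' (ADD ∙ m ∙ n).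
Proof.
  revert n. refine (int_ind (p := (t_add · (Succ · #1) · #0 ≐ Succ · (t_add · #1 · #0))%form)
    (e := vcons m vnil) I _ _); cbn [holds]; ev.
  - now rewrite !add_0_r.
  - intros n H. evin H. ev. now rewrite !add_S_r, H.
Qed.

Lemma add_comm m n : ADD ∙ m ∙ n = ADD ∙ n ∙ m.
Proof.
  revert n. refine (int_ind (p := (t_add · #1 · #0 ≐ t_add · #0 · #1)%form)
    (e := vcons m vnil) I _ _); cbn [holds]; ev.
  - now rewrite add_0_r, add_0_l.
  - intros n H. evin H. ev. now rewrite add_S_r, add_S_l, H.
Qed.

Lemma add_assoc m n k : ADD ∙ m ∙ (ADD ∙ n ∙ k) = ADD ∙ (ADD ∙ m ∙ n) ∙ k.
Proof.
  revert k. refine (int_ind (p := (t_add · #1 · (t_add · #2 · #0) ≐ t_add · (t_add · #1 · #2) · #0)%form)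
    (e := vcons m (vcons n vnil)) I _ _); cbn [holds]; ev.
  - now rewrite !add_0_r.
  - intros k H. evin H. ev. now rewrite !add_S_r, H.
Qed.

Lemma le_refl n : le n n.
Proof. exists O. apply add_0_r. Qed.

Lemma le_0 n : le O n.
Proof. exists n. apply add_0_l. Qed.

Lemma le_trans m n k : le m n -> le n k -> le m k.
Proof. intros [a <-] [b <-]. exists (ADD ∙ a ∙ b). apply add_assoc. Qed.

Lemma le_add_r m n : le m (ADD ∙ m ∙ n).
Proof. now exists n. Qed.

Lemma le_add_l m n : le m (ADD ∙ n ∙ m).
Proof. exists n. apply add_comm. Qed.

Lemma le_succ n : le n (S' n).
Proof. exists (S' O). now rewrite add_S_r, add_0_r. Qed.

Lemma le_S m n : le m n -> le m (S' n).
Proof. intro H. eapply le_trans; [exact H | apply le_succ]. Qed.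

Lemma le_S_S m n : le (S' m) (S' n) <-> le m n.
Proof.
  split; intros [k H]; exists k.
  - rewrite add_S_l in H. now apply S_inj.
  - now rewrite add_S_l, H.
Qed.

Lemma le_0_r n : le n O -> n = O.
Proof.
  intros [k H]. destruct (num_cases n) as [->|[m ->]]; [reflexivity|].
  rewrite add_S_l in H. now apply S_neq_0 in H.
Qed.

Lemma lt_le m n : lt m n -> le m n.
Proof. intro H. eapply le_trans; [apply le_succ | exact H]. Qed.

Lemma lt_S m n : lt m (S' n) <-> le m n.
Proof. apply le_S_S. Qed.

Lemma le_lt_or_eq m n : le m n -> lt m n \/ m = n.
Proof.
  intros [k <-]. destruct (num_cases k) as [->|[j ->]].
  - right. now rewrite add_0_r.
  - left. exists j. now rewrite add_S_l, add_S_r.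
Qed.

Lemma le_or_lt m n : le m n \/ lt n m.
Proof.
  revert n.
  refine (int_ind (p := ((∃ N0, t_add · #2 · #0 ≐ #1) ⩔ (∃ N0, t_add · (Succ · #1) · #0 ≐ #2))%form)
    (e := vcons m vnil) _ _ _); [cbn; tauto | |].
  - change (le m O \/ lt O m).
    destruct (num_cases m) as [->|[k ->]]; [left; apply le_refl | right].
    apply le_S_S. apply le_0.
  - intros n H. change (le m n \/ lt n m) in H. change (le m (S' n) \/ lt (S' n) m).
    destruct H as [H|H].
    + left. now apply le_S.
    + destruct (le_lt_or_eq H) as [K|K]; [now right | left]. rewrite <- K. apply le_refl.
Qed.

Lemma lt_irrefl n : ~ lt n n.
Proof.
  revert n. refine (int_ind (p := (¬ ∃ N0, t_add · (Succ · #1) · #0 ≐ #1)%form) (e := vnil) _ _ _);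
    [cbn; tauto | |].
  - change (~ le (S' O) O). intros H. apply le_0_r in H. now apply S_neq_0 in H.
  - intros n H. change (~ le (S' n) n) in H. change (~ le (S' (S' n)) (S' n)).
    now rewrite le_S_S.
Qed.

Lemma le_lt_trans m n k : le m n -> lt n k -> lt m k.
Proof. intros H K. eapply le_trans; [apply le_S_S; exact H | exact K]. Qed.

Lemma lt_le_trans m n k : lt m n -> le n k -> lt m k.
Proof. apply le_trans. Qed.

Lemma le_not_lt m n : le m n -> ~ lt n m.
Proof. intros H K. apply (@lt_irrefl m). eapply le_lt_trans; eassumption. Qed.

Lemma not_lt_0 n : ~ lt n O.
Proof. intro H. apply le_0_r in H. now apply S_neq_0 in H. Qed.

Lemma add_eq_0 m n : ADD ∙ m ∙ n = O -> m = O /\ n = O.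
Proof.
  intro H. split; apply le_0_r; rewrite <- H; [apply le_add_r | apply le_add_l].
Qed.

Lemma monus_S_S m n : MONUS ∙ (S' m) ∙ (S' n) = MONUS ∙ m ∙ n.
Proof.
  revert n. refine (int_ind (p := (t_monus · (Succ · #1) · (Succ · #0) ≐ t_monus · #1 · #0)%form)
    (e := vcons m vnil) I _ _); cbn [holds]; ev.
  - now rewrite monus_S_r, !monus_0_r, pred_S.
  - intros n H. evin H. ev. now rewrite monus_S_r, H, <- monus_S_r.
Qed.

Lemma monus_0_l n : MONUS ∙ O ∙ n = O.
Proof.
  revert n. refine (int_ind (p := (t_monus · Zero · #0 ≐ Zero)%form) (e := vnil) I _ _);
    cbn [holds]; ev; [apply monus_0_r|]. intros n H. evin H. ev. now rewrite monus_S_r, H, pred_0.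
Qed.

Lemma monus_add m n : MONUS ∙ (ADD ∙ m ∙ n) ∙ m = n.
Proof.
  revert m. refine (int_ind (p := (t_monus · (t_add · #0 · #1) · #0 ≐ #1)%form)
    (e := vcons n vnil) I _ _); cbn [holds]; ev.
  - now rewrite monus_0_r, add_0_l.
  - intros m H. evin H. ev. now rewrite add_S_l, monus_S_S.
Qed.

Lemma monus_le m n : le m n -> MONUS ∙ m ∙ n = O.
Proof.
  intros [k <-]. revert m.
  refine (int_ind (p := (t_monus · #0 · (t_add · #0 · #1) ≐ Zero)%form)
    (e := vcons k vnil) I _ _); cbn [holds]; ev.
  - apply monus_0_l.
  - intros m H. evin H. ev. now rewrite add_S_l, monus_S_S.
Qed.

Lemma monus_lt m n : lt n m -> exists k, MONUS ∙ m ∙ n = S' k.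
Proof.
  intros [k <-]. exists k. rewrite add_S_l, <- add_S_r. apply monus_add.
Qed.

Lemma monus_eq_0 m n : MONUS ∙ m ∙ n = O -> le m n.
Proof.
  intro H. destruct (le_or_lt m n) as [K|K]; [exact K|].
  apply monus_lt in K. destruct K as [k K]. rewrite H in K. symmetry in K. now apply S_neq_0 in K.
Qed.

Lemma le_antisym m n : le m n -> le n m -> m = n.
Proof.
  intros H K. destruct (le_lt_or_eq H) as [L|L]; [|exact L]. now apply le_not_lt in K.
Qed.

Lemma ifz_0 a b : IFZ ∙ O ∙ a ∙ b = a.
Proof. unfold IFZ. with_strategy transparent [t_ifz] unfold t_ifz. ev. apply rec_0. Qed.

Lemma ifz_nz n a b : n <> O -> IFZ ∙ n ∙ a ∙ b = b.
Proof.
  intro H. destruct (num_cases n) as [->|[m ->]]; [contradiction|].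
  unfold IFZ. with_strategy transparent [t_ifz] unfold t_ifz. ev. rewrite rec_S. ev. reflexivity.
Qed.

Lemma sum_0 f : SUM ∙ f ∙ O = O.
Proof. unfold SUM. with_strategy transparent [t_sum] unfold t_sum. ev. apply rec_0. Qed.

Lemma sum_S f n : SUM ∙ f ∙ (S' n) = ADD ∙ (SUM ∙ f ∙ n) ∙ (f ∙ n).
Proof. unfold SUM. with_strategy transparent [t_sum] unfold t_sum. ev. rewrite rec_S. ev. reflexivity. Qed.

Lemma sum_le f i n : lt i n -> le (f ∙ i) (SUM ∙ f ∙ n).
Proof.
  intros [k <-]. revert k.
  refine (int_ind (p := (∃ N0, t_add · (#2 · #3) · #0 ≐ t_sum · #2 · (t_add · (Succ · #3) · #1))%form)
    (e := vcons f (vcons i vnil)) I _ _).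
  - change (le (f ∙ i) (SUM ∙ f ∙ (ADD ∙ (S' i) ∙ O))).
    rewrite add_0_r, sum_S. apply le_add_l.
  - intros k H. change (le (f ∙ i) (SUM ∙ f ∙ (ADD ∙ (S' i) ∙ (S' k)))).
    change (le (f ∙ i) (SUM ∙ f ∙ (ADD ∙ (S' i) ∙ k))) in H.
    rewrite add_S_r, sum_S. eapply le_trans; [exact H | apply le_add_r].
Qed.

Lemma sum_const_0 f n : (forall i, f ∙ i = O) -> SUM ∙ f ∙ n = O.
Proof.
  intro H. revert n. refine (int_ind (p := (t_sum · #1 · #0 ≐ Zero)%form)
    (e := vcons f vnil) I _ _); cbn [holds]; ev.
  - apply sum_0.
  - intros n K. evin K. ev. now rewrite sum_S, K, H, add_0_r.
Qed.

Lemma search_0 f : SEARCH ∙ f ∙ O = O.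
Proof. unfold SEARCH. with_strategy transparent [t_search] unfold t_search. ev. apply rec_0. Qed.

Lemma search_S f n : SEARCH ∙ f ∙ (S' n) =
  IFZ ∙ (f ∙ (SEARCH ∙ f ∙ n)) ∙ (S' (SEARCH ∙ f ∙ n)) ∙ (SEARCH ∙ f ∙ n).
Proof.
  unfold SEARCH. with_strategy transparent [t_search] unfold t_search. ev. rewrite rec_S. ev. reflexivity.
Qed.

Lemma search_cases f n : SEARCH ∙ f ∙ n = n \/ f ∙ (SEARCH ∙ f ∙ n) <> O.
Proof.
  revert n. refine (int_ind
    (p := (t_search · #1 · #0 ≐ #0 ⩔ ¬ (#1 · (t_search · #1 · #0) ≐ Zero))%form)
    (e := vcons f vnil) _ _ _); [cbn; tauto | |].
  - left. apply search_0.
  - intros n H. change (SEARCH ∙ f ∙ n = n \/ f ∙ (SEARCH ∙ f ∙ n) <> O) in H.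
    change (SEARCH ∙ f ∙ (S' n) = S' n \/ f ∙ (SEARCH ∙ f ∙ (S' n)) <> O).
    rewrite search_S. destruct (classic (f ∙ (SEARCH ∙ f ∙ n) = O)) as [E|E].
    + rewrite E, ifz_0. left. destruct H as [->|H]; [reflexivity | contradiction].
    + rewrite (ifz_nz _ _ E). now right.
Qed.

Lemma search_le f i n : f ∙ i <> O -> le (SEARCH ∙ f ∙ n) i.
Proof.
  intro Hi. revert n. refine (int_ind
    (p := (∃ N0, t_add · (t_search · #2 · #1) · #0 ≐ #3)%form)
    (e := vcons f (vcons i vnil)) I _ _).
  - change (le (SEARCH ∙ f ∙ O) i). rewrite search_0. apply le_0.
  - intros n H. change (le (SEARCH ∙ f ∙ n) i) in H. change (le (SEARCH ∙ f ∙ (S' n)) i).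
    rewrite search_S. destruct (classic (f ∙ (SEARCH ∙ f ∙ n) = O)) as [E|E].
    + rewrite E, ifz_0. destruct (le_lt_or_eq H) as [K|K]; [exact K | congruence].
    + now rewrite (ifz_nz _ _ E).
Qed.

(** * Finite sequences in a model *)

Local Notation nil' := (d_nil M N0).
Local Notation cons' x l := (d_cons M N0 ∙ x ∙ l).

Lemma seq_cases (l : M (N0^*)%ty) : l = nil' \/ exists x l', l = cons' x l'.
Proof. exact (HEPA (epa_seq (G := [N0^*]%ty) (Var vz)) (vcons l vnil)). Qed.

Lemma len_nil : LEN ∙ nil' = O.
Proof. unfold LEN. with_strategy transparent [t_len] unfold t_len. ev. apply lrec_nil. Qed.

Lemma len_cons x l : LEN ∙ (cons' x l) = S' (LEN ∙ l).
Proof. unfold LEN. with_strategy transparent [t_len] unfold t_len. ev. rewrite lrec_cons. ev. reflexivity. Qed.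

(** Reduced to number induction on the length, for the internal formula that quantifies over all
    sequences of length [n]. *)
Lemma list_ind G (p : form (N0^* :: G)%ty) (e : val M G) : internal p ->
  holds p (vcons nil' e) ->
  (forall x l, holds p (vcons l e) -> holds p (vcons (cons' x l) e)) ->
  forall l, holds p (vcons l e).
Proof.
  intros Hp H0 HS.
  assert (H : forall n l, LEN ∙ l = n -> holds p (vcons l e)).
  { intro n. assert (K : forall l, LEN ∙ l = n ->
        holds (fren (upr (r := (N0^*)%ty) shift) p) (vcons l (vcons n e))).
    { revert n. refine (int_ind (p := (∀ N0^*, t_len · #0 ≐ #1 ⟶ fren (upr (r := (N0^*)%ty) shift) p)%form)
        (e := e) _ _ _).
      - split; [exact I|]. rewrite fren_as_fsub. now apply internal_fsub.
      - intros l H. change (LEN ∙ l = O) in H. apply holds_fren. rewrite vcons_upr.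
        destruct (seq_cases l) as [->|(x & l' & ->)]; [exact H0|].
        rewrite len_cons in H. now apply S_neq_0 in H.
      - intros n IH l H. change (LEN ∙ l = S' n) in H. apply holds_fren. rewrite vcons_upr.
        destruct (seq_cases l) as [->|(x & l' & ->)]; [exact H0|].
        rewrite len_cons in H. apply S_inj in H.
        apply HS. assert (K : holds (fren (upr (r := (N0^*)%ty) shift) p) (vcons l' (vcons n e)))
          by exact (IH l' H). rewrite holds_fren, vcons_upr in K. exact K. }
    intros l H. specialize (K l H). rewrite holds_fren, vcons_upr in K. exact K. }
  intro l. exact (H _ l eq_refl).
Qed.

Lemma zerosE n : ZEROS ∙ n = O.
Proof. unfold ZEROS. with_strategy transparent [zeros] unfold zeros. ev. reflexivity. Qed.

Lemma nth_cons_0 x l : NTH ∙ (cons' x l) ∙ O = x.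
Proof. unfold NTH. with_strategy transparent [t_nth] unfold t_nth. ev. rewrite lrec_cons. ev. apply rec_0. Qed.

Lemma nth_cons_S x l i : NTH ∙ (cons' x l) ∙ (S' i) = NTH ∙ l ∙ i.
Proof. unfold NTH. with_strategy transparent [t_nth] unfold t_nth. ev. rewrite lrec_cons. ev. rewrite rec_S. ev. reflexivity. Qed.

Lemma app_nil l : APP ∙ nil' ∙ l = l.
Proof. unfold APP. with_strategy transparent [t_app] unfold t_app. ev. apply lrec_nil. Qed.

Lemma app_cons x l m : APP ∙ (cons' x l) ∙ m = cons' x (APP ∙ l ∙ m).
Proof. unfold APP. with_strategy transparent [t_app] unfold t_app. ev. rewrite lrec_cons. ev. reflexivity. Qed.

Lemma init_0 f : INIT ∙ f ∙ O = nil'.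
Proof. unfold INIT. with_strategy transparent [t_init] unfold t_init. ev. apply rec_0. Qed.

Lemma init_S f n : INIT ∙ f ∙ (S' n) = APP ∙ (INIT ∙ f ∙ n) ∙ (cons' (f ∙ n) nil').
Proof. unfold INIT. with_strategy transparent [t_init] unfold t_init. ev. rewrite rec_S. ev. reflexivity. Qed.

Lemma lsum_cons x l : LSUM ∙ (cons' x l) = ADD ∙ (LSUM ∙ l) ∙ x.
Proof. unfold LSUM. with_strategy transparent [t_lsum] unfold t_lsum. ev. rewrite lrec_cons. ev. reflexivity. Qed.

Lemma app_len l m : LEN ∙ (APP ∙ l ∙ m) = ADD ∙ (LEN ∙ l) ∙ (LEN ∙ m).
Proof.
  revert l. refine (list_ind (p := (t_len · (t_app · #0 · #1) ≐ t_add · (t_len · #0) · (t_len · #1))%form)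
    (e := vcons m vnil) I _ _); cbn [holds]; ev.
  - now rewrite app_nil, len_nil, add_0_l.
  - intros x l H. evin H. ev. now rewrite app_cons, !len_cons, add_S_l, H.
Qed.

Lemma app_nth_lt l m i : lt i (LEN ∙ l) -> NTH ∙ (APP ∙ l ∙ m) ∙ i = NTH ∙ l ∙ i.
Proof.
  revert i. revert l. refine (list_ind
    (p := (∀ N0, (∃ N0, t_add · (Succ · #1) · #0 ≐ t_len · #2)
             ⟶ t_nth · (t_app · #1 · #2) · #0 ≐ t_nth · #1 · #0)%form)
    (e := vcons m vnil) _ _ _); [cbn; tauto | |].
  - intros i H. change (lt i (LEN ∙ nil')) in H. rewrite len_nil in H. now apply not_lt_0 in H.
  - intros x l IH i H. change (lt i (LEN ∙ (cons' x l))) in H.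
    change (forall i, lt i (LEN ∙ l) -> NTH ∙ (APP ∙ l ∙ m) ∙ i = NTH ∙ l ∙ i) in IH.
    change (NTH ∙ (APP ∙ (cons' x l) ∙ m) ∙ i = NTH ∙ (cons' x l) ∙ i).
    rewrite app_cons. rewrite len_cons in H.
    destruct (num_cases i) as [->|[j ->]]; [now rewrite !nth_cons_0|].
    rewrite !nth_cons_S. apply IH. now apply le_S_S.
Qed.

Lemma app_nth_ge l m j : NTH ∙ (APP ∙ l ∙ m) ∙ (ADD ∙ (LEN ∙ l) ∙ j) = NTH ∙ m ∙ j.
Proof.
  revert l. refine (list_ind
    (p := (t_nth · (t_app · #0 · #1) · (t_add · (t_len · #0) · #2) ≐ t_nth · #1 · #2)%form)
    (e := vcons m (vcons j vnil)) I _ _); cbn [holds]; ev.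
  - now rewrite app_nil, len_nil, add_0_l.
  - intros x l H. evin H. ev. now rewrite app_cons, len_cons, add_S_l, nth_cons_S.
Qed.

Lemma init_len f n : LEN ∙ (INIT ∙ f ∙ n) = n.
Proof.
  revert n. refine (int_ind (p := (t_len · (t_init · #1 · #0) ≐ #0)%form)
    (e := vcons f vnil) I _ _); cbn [holds]; ev.
  - now rewrite init_0, len_nil.
  - intros n H. evin H. ev.
    now rewrite init_S, app_len, H, len_cons, len_nil, add_S_r, add_0_r.
Qed.

Lemma init_nth f i n : lt i n -> NTH ∙ (INIT ∙ f ∙ n) ∙ i = f ∙ i.
Proof.
  revert n. refine (int_ind
    (p := ((∃ N0, t_add · (Succ · #3) · #0 ≐ #1) ⟶ t_nth · (t_init · #1 · #0) · #2 ≐ #1 · #2)%form)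
    (e := vcons f (vcons i vnil)) _ _ _); [cbn; tauto | |].
  - intro H. change (lt i O) in H. now apply not_lt_0 in H.
  - intros n IH H. change (lt i (S' n)) in H.
    change (lt i n -> NTH ∙ (INIT ∙ f ∙ n) ∙ i = f ∙ i) in IH.
    change (NTH ∙ (INIT ∙ f ∙ (S' n)) ∙ i = f ∙ i).
    rewrite init_S. apply (proj1 (lt_S _ _)), le_lt_or_eq in H. destruct H as [H| ->].
    + rewrite app_nth_lt; [now apply IH | now rewrite init_len].
    + transitivity (NTH ∙ (APP ∙ (INIT ∙ f ∙ n) ∙ (cons' (f ∙ n) nil')) ∙ (ADD ∙ (LEN ∙ (INIT ∙ f ∙ n)) ∙ O)).
      * now rewrite add_0_r, init_len.
      * now rewrite app_nth_ge, nth_cons_0.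
Qed.

Lemma nth_le_lsum l i : lt i (LEN ∙ l) -> le (NTH ∙ l ∙ i) (LSUM ∙ l).
Proof.
  revert i. revert l. refine (list_ind
    (p := (∀ N0, (∃ N0, t_add · (Succ · #1) · #0 ≐ t_len · #2)
             ⟶ ∃ N0, t_add · (t_nth · #2 · #1) · #0 ≐ t_lsum · #2)%form)
    (e := vnil) _ _ _); [cbn; tauto | |].
  - intros i H. change (lt i (LEN ∙ nil')) in H. rewrite len_nil in H. now apply not_lt_0 in H.
  - intros x l IH i H. change (lt i (LEN ∙ (cons' x l))) in H.
    change (forall i, lt i (LEN ∙ l) -> le (NTH ∙ l ∙ i) (LSUM ∙ l)) in IH.
    change (le (NTH ∙ (cons' x l) ∙ i) (LSUM ∙ (cons' x l))).
    rewrite len_cons in H. rewrite lsum_cons.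
    destruct (num_cases i) as [->|[j ->]].
    + rewrite nth_cons_0. apply le_add_l.
    + rewrite nth_cons_S. eapply le_trans; [apply IH; now apply le_S_S | apply le_add_r].
Qed.

Lemma double_S n : DOUBLE ∙ (S' n) = S' (S' (DOUBLE ∙ n)).
Proof. unfold DOUBLE. with_strategy transparent [t_double] unfold t_double. ev. now rewrite add_S_l, add_S_r. Qed.

Lemma double_0 : DOUBLE ∙ O = O.
Proof. unfold DOUBLE. with_strategy transparent [t_double] unfold t_double. ev. apply add_0_r. Qed.

Lemma enc_nil : ENC ∙ nil' = O.
Proof. unfold ENC. with_strategy transparent [t_enc] unfold t_enc. ev. apply lrec_nil. Qed.

Lemma enc_cons_0 l : ENC ∙ (cons' O l) = S' (DOUBLE ∙ (ENC ∙ l)).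
Proof. unfold ENC. with_strategy transparent [t_enc] unfold t_enc. ev. rewrite lrec_cons. ev. rewrite rec_0. reflexivity. Qed.

Lemma enc_cons_S x l : ENC ∙ (cons' (S' x) l) = DOUBLE ∙ (ENC ∙ (cons' x l)).
Proof.
  unfold ENC. with_strategy transparent [t_enc] unfold t_enc. ev. rewrite !lrec_cons. ev. rewrite rec_S. ev. reflexivity.
Qed.

Lemma sdouble_nil : SDOUBLE ∙ nil' = nil'.
Proof. unfold SDOUBLE. with_strategy transparent [t_seq_double] unfold t_seq_double. ev. apply lrec_nil. Qed.

Lemma sdouble_cons x l : SDOUBLE ∙ (cons' x l) = cons' (S' x) l.
Proof. unfold SDOUBLE. with_strategy transparent [t_seq_double] unfold t_seq_double. ev. rewrite lrec_cons. ev. reflexivity. Qed.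

Lemma ssucc_nil : SSUCC ∙ nil' = cons' O nil'.
Proof. unfold SSUCC. with_strategy transparent [t_seq_succ] unfold t_seq_succ. ev. apply lrec_nil. Qed.

Lemma ssucc_cons_0 l : SSUCC ∙ (cons' O l) = SDOUBLE ∙ (SSUCC ∙ l).
Proof. unfold SSUCC. with_strategy transparent [t_seq_succ] unfold t_seq_succ. ev. rewrite lrec_cons. ev. rewrite rec_0. reflexivity. Qed.

Lemma ssucc_cons_S x l : SSUCC ∙ (cons' (S' x) l) = cons' O (cons' x l).
Proof. unfold SSUCC. with_strategy transparent [t_seq_succ] unfold t_seq_succ. ev. rewrite lrec_cons. ev. rewrite rec_S. ev. reflexivity. Qed.

Lemma dec_0 : DEC ∙ O = nil'.
Proof. unfold DEC. with_strategy transparent [t_dec] unfold t_dec. ev. apply rec_0. Qed.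

Lemma dec_S n : DEC ∙ (S' n) = SSUCC ∙ (DEC ∙ n).
Proof. unfold DEC. with_strategy transparent [t_dec] unfold t_dec. ev. rewrite rec_S. ev. reflexivity. Qed.

Lemma ssucc_sdouble l : SSUCC ∙ (SDOUBLE ∙ l) = cons' O l.
Proof.
  destruct (seq_cases l) as [->|(x & l' & ->)].
  - now rewrite sdouble_nil, ssucc_nil.
  - now rewrite sdouble_cons, ssucc_cons_S.
Qed.

Lemma dec_double n : DEC ∙ (DOUBLE ∙ n) = SDOUBLE ∙ (DEC ∙ n).
Proof.
  revert n. refine (int_ind (p := (t_dec · (t_double · #0) ≐ t_seq_double · (t_dec · #0))%form)
    (e := vnil) I _ _); cbn [holds]; ev.
  - now rewrite double_0, dec_0, sdouble_nil.
  - intros n H. evin H. ev. now rewrite double_S, !dec_S, H, ssucc_sdouble, ssucc_cons_0.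
Qed.

(** The code of a sequence with head [x] arises by [x] doublings from the one with head 0, hence an
    inner induction on the head. *)
Lemma dec_enc l : DEC ∙ (ENC ∙ l) = l.
Proof.
  revert l. refine (list_ind (p := (t_dec · (t_enc · #0) ≐ #0)%form) (e := vnil) I _ _);
    cbn [holds]; ev.
  - now rewrite enc_nil, dec_0.
  - intros x l H. evin H. ev. revert x.
    refine (int_ind (p := (t_dec · (t_enc · (Cons · #0 · #1)) ≐ Cons · #0 · #1)%form)
      (e := vcons l vnil) I _ _); cbn [holds]; ev.
    + now rewrite enc_cons_0, dec_S, dec_double, H, ssucc_sdouble.
    + intros x K. evin K. ev. now rewrite enc_cons_S, dec_double, K, sdouble_cons.
Qed.

Lemma clenE s : CLEN ∙ s = LEN ∙ (DEC ∙ s).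
Proof. unfold CLEN. with_strategy transparent [c_len] unfold c_len. ev. reflexivity. Qed.

Lemma cnthE s i : CNTH ∙ s ∙ i = NTH ∙ (DEC ∙ s) ∙ i.
Proof. unfold CNTH. with_strategy transparent [c_nth] unfold c_nth. ev. reflexivity. Qed.

Lemma dec_unit x : DEC ∙ (CUNIT ∙ x) = cons' x nil'.
Proof. unfold CUNIT. with_strategy transparent [c_unit] unfold c_unit. ev. apply dec_enc. Qed.

Lemma dec_cat s t : DEC ∙ (CCAT ∙ s ∙ t) = APP ∙ (DEC ∙ s) ∙ (DEC ∙ t).
Proof. unfold CCAT. with_strategy transparent [c_cat] unfold c_cat. ev. apply dec_enc. Qed.

Lemma dec_init f n : DEC ∙ (CINIT ∙ f ∙ n) = INIT ∙ f ∙ n.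
Proof. unfold CINIT. with_strategy transparent [c_init] unfold c_init. ev. apply dec_enc. Qed.

Lemma snocE s n : SNOC ∙ s ∙ n = CCAT ∙ s ∙ (CUNIT ∙ (S' n)).
Proof. unfold SNOC. with_strategy transparent [t_snoc] unfold t_snoc. ev. reflexivity. Qed.

Lemma pair_fst a b : CNTH ∙ (PAIR ∙ a ∙ b) ∙ O = a.
Proof.
  rewrite cnthE. unfold PAIR. with_strategy transparent [t_pair] unfold t_pair. ev. rewrite dec_enc. apply nth_cons_0.
Qed.

Lemma pair_snd a b : CNTH ∙ (PAIR ∙ a ∙ b) ∙ (S' O) = b.
Proof.
  rewrite cnthE. unfold PAIR. with_strategy transparent [t_pair] unfold t_pair. ev. rewrite dec_enc, nth_cons_S. apply nth_cons_0.
Qed.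

Lemma catf_lt s a i : lt i (CLEN ∙ s) -> CATF ∙ s ∙ a ∙ i = CNTH ∙ s ∙ i.
Proof.
  intro H. apply monus_lt in H. destruct H as [k H].
  unfold CATF. with_strategy transparent [c_catf] unfold c_catf. ev. rewrite H, rec_S. ev. reflexivity.
Qed.

Lemma catf_ge s a j : CATF ∙ s ∙ a ∙ (ADD ∙ (CLEN ∙ s) ∙ j) = a ∙ j.
Proof.
  unfold CATF. with_strategy transparent [c_catf] unfold c_catf. ev. rewrite (monus_le (le_add_r _ _)), rec_0, monus_add. reflexivity.
Qed.

Lemma cinit_inj f g n i : CINIT ∙ f ∙ n = CINIT ∙ g ∙ n -> lt i n -> f ∙ i = g ∙ i.
Proof.
  intros H Hi. rewrite <- (init_nth f Hi), <- (init_nth g Hi), <- !dec_init. now rewrite H.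
Qed.

Lemma clen_cat s t : CLEN ∙ (CCAT ∙ s ∙ t) = ADD ∙ (CLEN ∙ s) ∙ (CLEN ∙ t).
Proof. now rewrite !clenE, dec_cat, app_len. Qed.

Lemma clen_unit x : CLEN ∙ (CUNIT ∙ x) = S' O.
Proof. now rewrite clenE, dec_unit, len_cons, len_nil. Qed.

Lemma clen_snoc s n : CLEN ∙ (SNOC ∙ s ∙ n) = S' (CLEN ∙ s).
Proof. now rewrite snocE, clen_cat, clen_unit, add_S_r, add_0_r. Qed.

Lemma cnth_cat_lt s t i : lt i (CLEN ∙ s) -> CNTH ∙ (CCAT ∙ s ∙ t) ∙ i = CNTH ∙ s ∙ i.
Proof. rewrite clenE, !cnthE, dec_cat. apply app_nth_lt. Qed.

Lemma cnth_cat_ge s t j :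
  CNTH ∙ (CCAT ∙ s ∙ t) ∙ (ADD ∙ (CLEN ∙ s) ∙ j) = CNTH ∙ t ∙ j.
Proof. rewrite clenE, !cnthE, dec_cat. apply app_nth_ge. Qed.

(** * Standard elements *)

Lemma std_app s r (f : M (s ⇒ r)%ty) x : std f -> std x -> std (f ∙ x).
Proof.
  intros H K. exact (HP (P_st_app (G := [s ⇒ r; s]%ty) (Var vz) (Var (vs vz)))
    (vcons f (vcons x vnil)) (conj H K)).
Qed.

Lemma std_closed s (t : tm nil s) : std (den t (vnil (M:=M))).
Proof.
  pose proof (HP (P_st_closed nil t) vnil) as H. cbn in H.
  unfold closed_tm in H. rewrite den_ren in H.
  replace (vnil (M:=M)) with (fun s x => vnil (M:=M) s (from_nil x)); [exact H|].
  apply functional_extensionality_dep; intro r.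
  apply functional_extensionality_dep; intro x.
  exact (var_nil_elim (fun y => vnil (M:=M) r (from_nil y) = vnil r y) x).
Qed.

Lemma val_nil_eq (e : val M nil) : e = vnil.
Proof.
  apply functional_extensionality_dep; intro r.
  apply functional_extensionality_dep; intro x.
  exact (var_nil_elim (fun y => e r y = vnil r y) x).
Qed.

(** The variables are abstracted one at a time, which leaves a closed term applied to standard
    elements. *)
Lemma std_den G : forall s (t : tm G s) (e : val M G),
  (forall s x, std (e s x)) -> std (den t e).
Proof.
  induction G as [|r G IH]; intros s t e He.
  - rewrite (val_nil_eq e). apply std_closed.
  - replace e with (vcons (e r vz) (fun s x => e s (vs x))) by (var_ext; reflexivity).
    rewrite <- beta. apply std_app; [|apply He]. apply IH. intros s' x. apply He.
Qed.

Lemma std_vnil : forall s x, std (vnil (M:=M) s x).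
Proof. intros s x. exact (var_nil_elim (fun y => std (vnil (M:=M) s y)) x). Qed.

Lemma std_vcons G r (a : M r) (e : val M G) : std a -> (forall s x, std (e s x)) ->
  forall s x, std (vcons a e (s:=s) x).
Proof.
  intros Ha He. exact (var_cons_ind (Q := fun s x => std (vcons a e x)) Ha He).
Qed.

Ltac std_tac := apply std_den; repeat apply std_vcons; try apply std_vnil; auto.

Lemma std_0 : std O.
Proof. exact (std_closed Zero). Qed.

Lemma std_S n : std n -> std (S' n).
Proof. apply std_app. exact (std_closed Succ). Qed.

Lemma std_le m n : std n -> le m n -> std m.
Proof.
  intros H. revert m. revert n H.
  refine (st_ind (p := (∀ N0, (∃ N0, t_add · #1 · #0 ≐ #2) ⟶ St #0)%form) (e := vnil) _ _).
  - intros m H. change (le m O) in H. change (std m). rewrite (le_0_r H). apply std_0.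
  - intros n Hn IH m H. change (le m (S' n)) in H. change (std m).
    change (forall m, le m n -> std m) in IH.
    destruct (le_lt_or_eq H) as [K| ->]; [|now apply std_S].
    apply IH. now apply le_S_S.
Qed.

Lemma std_lt_infinite n L : std n -> ~ std L -> lt n L.
Proof.
  intros Hn HL. destruct (le_or_lt L n) as [H|H]; [|exact H].
  destruct HL. eapply std_le; eassumption.
Qed.

(** If [p] held at standard numbers only, it would define standardness, and internal induction would
    make [L] standard. *)
Lemma overspill G (p : form (N0 :: G)) (e : val M G) (L : num) : internal p -> ~ std L ->
  (forall n, std n -> holds p (vcons n e)) -> exists n, ~ std n /\ holds p (vcons n e).
Proof.
  intros Hp HL H. apply NNPP. intro K.
  assert (A : forall n, holds p (vcons n e) -> std n).
  { intros n Hn. apply NNPP. intro Hs. apply K. now exists n. }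
  apply HL, A. apply (int_ind Hp).
  - apply H, std_0.
  - intros n Hn. apply H, std_S, A, Hn.
Qed.

(** * Continuity, choice and transfer *)

Definition approx (f g : M T1) := forall n, std n -> f ∙ n = g ∙ n.

Definition in_C (Y : M T2) := forall f, exists n, forall g,
  CINIT ∙ g ∙ n = CINIT ∙ f ∙ n -> Y ∙ f = Y ∙ g.

Lemma in_C_intro Y : (forall f, exists n, forall g,
  (forall i, lt i n -> g ∙ i = f ∙ i) -> Y ∙ f = Y ∙ g) -> in_C Y.
Proof.
  intros H f. destruct (H f) as [n K]. exists n. intros g Hg. apply K.
  intros i Hi. exact (cinit_inj Hg Hi).
Qed.

Lemma model_NPC Y f g : std Y -> in_C Y -> std f -> approx f g -> Y ∙ f = Y ∙ g.
Proof. intros HY HC Hf Hg. exact (HM (PNS_NPC nil) vnil Y HY HC f Hf g Hg). Qed.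

Lemma model_STP f : (forall n, le (f ∙ n) (S' O)) -> exists g, std g /\ approx f g.
Proof.
  intro H. destruct (HM (PNS_STP nil) vnil f H) as (g & Hg & _ & Ha).
  exists g. split; [exact Hg | exact Ha].
Qed.

(** Choice returns a finite list of candidates, and the sum of the list bounds every entry. The
    exact witness is lost, which does no harm for predicates that only ask for a bound. *)
Lemma HAC_bound G s (p : form (N0 :: s :: G)) (e : val M G) : internal p ->
  (forall x, std x -> exists y, std y /\ holds p (vcons y (vcons x e))) ->
  exists B : M (s ⇒ N0)%ty, std B /\
    forall x, std x -> exists y, le y (B ∙ x) /\ holds p (vcons y (vcons x e)).
Proof.
  intros Hp H. destruct (HP (P_HACint Hp) e H) as (F & HF & K).
  exists (den (λ s, t_lsum · (#1 · #0))%tm (vcons F vnil)). split; [std_tac|].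
  intros x Hx. destruct (K x Hx) as (y & (i & Hi & Hy) & Hp').
  exists y. split.
  - ev. destruct Hi as [z Hz].
    change (ADD ∙ i ∙ (S' z) = LEN ∙ (F ∙ x)) in Hz. change (y = NTH ∙ (F ∙ x) ∙ i) in Hy.
    rewrite Hy. apply nth_le_lsum. exists z. now rewrite add_S_l, <- add_S_r.
  - change (holds (fren (upr (r:=N0) (upr (r:=s) shift)) p) (vcons y (vcons x (vcons F e)))) in Hp'.
    rewrite holds_fren, vcons_upr, vcons_upr in Hp'. exact Hp'.
Qed.

Variable L : num.
Hypothesis L_infinite : ~ std L.

(** Membership in C gives a modulus that may be infinite. If no standard one existed, overspill
    would give an infinite [n] and some [g] that agrees with [f] below [n] but has another value,
    against NPC. *)
Lemma std_modulus Y f : std Y -> in_C Y -> std f ->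
  exists n, std n /\ forall g, (forall i, lt i n -> g ∙ i = f ∙ i) -> Y ∙ g = Y ∙ f.
Proof.
  intros HY HC Hf. apply NNPP. intro K.
  destruct (overspill
    (p := (∃ T1, (∀ N0, (∃ N0, t_add · (Succ · #1) · #0 ≐ #3) ⟶ #1 · #0 ≐ #4 · #0)
             ⩓ ¬ (#2 · #0 ≐ #2 · #3))%form)
    (e := vcons Y (vcons f vnil)) (L := L)) as (n & Hn & g & Hg & Hd).
  - cbn; tauto.
  - exact L_infinite.
  - intros n Hn.
    change (exists g, (forall i, lt i n -> g ∙ i = f ∙ i) /\ ~ Y ∙ g = Y ∙ f).
    apply NNPP. intro N. apply K. exists n. split; [exact Hn|].
    intros g Hg. apply NNPP. intro E. apply N. now exists g.
  - change (forall i, lt i n -> g ∙ i = f ∙ i) in Hg. change (~ Y ∙ g = Y ∙ f) in Hd.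
    apply Hd. symmetry. apply model_NPC; auto.
    intros i Hi. symmetry. apply Hg. now apply std_lt_infinite.
Qed.

(** Membership in C is a premise inside the internal formula, so that choice can range over all
    standard [Y]; outside C the witness 0 is a dummy. A number above a modulus is again a
    modulus. *)
Lemma modulus_functional : exists F : M (T2 ⇒ N0)%ty, std F /\
  forall Y, std Y -> in_C Y -> forall g, (forall i, lt i (F ∙ Y) -> g ∙ i = O) -> Y ∙ g = Y ∙ ZEROS.
Proof.
  destruct (HAC_bound (s := T2)
    (p := (inC #1 ⟶ ∀ T1, (∀ N0, (∃ N0, t_add · (Succ · #1) · #0 ≐ #3) ⟶ #1 · #0 ≐ Zero)
             ⟶ #2 · #0 ≐ #2 · zeros)%form) (e := vnil)) as (F & HF & K).
  - cbn; tauto.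
  - intros Y HY. destruct (classic (in_C Y)) as [HC|HC].
    + destruct (std_modulus HY HC (f := ZEROS)) as (n & Hn & H); [apply std_closed|].
      exists n. split; [exact Hn|]. intros _ g Hg.
      change (forall i, lt i n -> g ∙ i = O) in Hg. change (Y ∙ g = Y ∙ ZEROS).
      apply H. intros i Hi. rewrite zerosE. now apply Hg.
    + exists O. split; [apply std_0|]. intro H. destruct (HC H).
  - exists F. split; [exact HF|]. intros Y HY HC g Hg.
    destruct (K Y HY) as (n & Hn & H).
    apply (H HC). intros i Hi. change (lt i n) in Hi. change (g ∙ i = O).
    apply Hg. eapply le_trans; [exact Hi | exact Hn].
Qed.

(* Grilliot's trick. The standard functional [Z] separates 0 from the indicator
   [d] of the first [n0] with [g n0 <> 0], and [Z h] depends on [h n0] only; so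
   NPC forces [n0] to be standard. *)
Lemma transfer (g : M T1) : std g -> (forall n, std n -> g ∙ n = O) -> forall n, g ∙ n = O.
Proof.
  intros Hg Hst. apply NNPP. intro Hne.
  (* [d] keeps [g n] where the sum of all earlier values is 0 and vanishes elsewhere, so its only
     nonzero argument is the first one of [g]. *)
  set (d := den (λ N0, t_ifz · (t_sum · #1 · #0) · (#1 · #0) · Zero)%tm (vcons g vnil) : M T1).
  assert (dE : forall n, d ∙ n = IFZ ∙ (SUM ∙ g ∙ n) ∙ (g ∙ n) ∙ O).
  { intro n. unfold d. ev. reflexivity. }
  assert (d_nz : forall n, d ∙ n <> O -> SUM ∙ g ∙ n = O /\ g ∙ n <> O).
  { intros n. rewrite dE. destruct (classic (SUM ∙ g ∙ n = O)) as [E|E].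
    - rewrite E, ifz_0. auto.
    - rewrite (ifz_nz _ _ E). tauto. }
  assert (Hd : std d) by (unfold d; std_tac).
  assert (Hn0 : exists n0, d ∙ n0 <> O).
  { apply NNPP. intro N. apply Hne.
    assert (Z : forall n, d ∙ n = O) by (intro n; apply NNPP; intro; apply N; now exists n).
    assert (S0 : forall n, SUM ∙ g ∙ n = O).
    { refine (int_ind (p := (t_sum · #1 · #0 ≐ Zero)%form) (e := vcons g vnil) I _ _);
        cbn [holds]; ev; [apply sum_0|].
      intros n H. evin H. ev. rewrite sum_S, H, add_0_l.
      pose proof (Z n) as Zn. now rewrite dE, H, ifz_0 in Zn. }
    intro n. pose proof (Z n) as Zn. now rewrite dE, S0, ifz_0 in Zn. }
  destruct Hn0 as [n0 Hn0].
  assert (d_uniq : forall n, d ∙ n <> O -> n = n0).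
  { assert (A : forall m n, d ∙ m <> O -> d ∙ n <> O -> ~ lt m n).
    { intros m n Hm Hn H. destruct (d_nz m Hm) as [_ Hm']. apply Hm', le_0_r.
      rewrite <- (proj1 (d_nz n Hn)). now apply sum_le. }
    intros n Hn. destruct (le_or_lt n n0) as [H|H].
    - destruct (le_lt_or_eq H) as [K|K]; [destruct (A n n0 Hn Hn0 K) | exact K].
    - destruct (A n0 n Hn0 Hn H). }
  destruct modulus_functional as (F & HF & HFm).
  set (K := F ∙ den (λ T1, Zero)%tm vnil).
  assert (HK : std K) by (apply std_app; [exact HF | apply std_closed]).
  (* [W k] looks at its argument only at [K], one place beyond what the modulus [K] of the zero
     functional inspects. For [k = 0] it is the zero functional, so [F] takes the value [K]
     there. *)
  set (W := fun k : M T1 => den (λ T1, t_sum · #1 · (Succ · (#0 · #2)))%tm (vcons k (vcons K vnil)) : M T2).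
  assert (WE : forall k h, W k ∙ h = SUM ∙ k ∙ (S' (h ∙ K))) by (intros; unfold W; ev; reflexivity).
  assert (W0 : F ∙ (W ZEROS) = K).
  { unfold K. f_equal. apply ext. intro h. rewrite WE. ev. apply sum_const_0, zerosE. }
  assert (Wd : F ∙ (W d) <> K).
  { intro E.
    assert (HW : std (W d)) by (unfold W; std_tac).
    assert (HC : in_C (W d)).
    { apply in_C_intro. intro f. exists (S' K). intros h Hh. rewrite !WE, Hh; [reflexivity|].
      apply le_refl. }
    (* [h] is 0 below [K] and [n0] from [K] on. With modulus [K], [W d] could not tell [h] from 0;
       yet its value at [h] is at least [d n0], and at 0 it is [d 0 = 0]. *)
    set (h := den (λ N0, t_ifz · (t_monus · (Succ · #0) · #1) · Zero · #2)%tm (vcons K (vcons n0 vnil)) : M T1).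
    assert (hE : forall i, h ∙ i = IFZ ∙ (MONUS ∙ (S' i) ∙ K) ∙ O ∙ n0) by (intro; unfold h; ev; reflexivity).
    pose proof (HFm (W d) HW HC h) as H. rewrite E, !WE, zerosE, hE in H.
    rewrite (ifz_nz (n := MONUS ∙ (S' K) ∙ K)) in H.
    2:{ destruct (monus_lt (m := S' K) (n := K)) as [k ->]; [apply le_refl | apply S_neq_0]. }
    rewrite (sum_S d O), sum_0, add_0_l, dE, sum_0, ifz_0, (Hst O std_0) in H.
    apply Hn0, le_0_r. rewrite <- H; [apply sum_le, le_refl|].
    intros i Hi. rewrite hE, monus_le, ifz_0; [reflexivity | exact Hi]. }
  (* The argument masks [d], which is nonzero at [n0] only: [Z h] is [F (W 0)] or [F (W d)]
     according to whether [h n0 = 0]. The infinite [n0] itself does not occur in the term, so [Z] is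
     standard. *)
  set (Z := den (λ T1, #1 · (λ T1, t_sum · (λ N0, t_ifz · (#2 · #0) · Zero · (#4 · #0)) · (Succ · (#0 · #4))))%tm
    (vcons F (vcons d (vcons K vnil))) : M T2).
  assert (ZE : forall h k, (forall n, k ∙ n = IFZ ∙ (h ∙ n) ∙ O ∙ (d ∙ n)) -> Z ∙ h = F ∙ (W k)).
  { intros h k Hk. unfold Z. ev. f_equal. apply ext. intro h'. rewrite WE. ev. f_equal. f_equal.
    apply ext. intro n. ev. now rewrite Hk. }
  assert (Z0 : forall h, h ∙ n0 = O -> Z ∙ h = K).
  { intros h Hh. rewrite <- W0. apply ZE. intro n. rewrite zerosE.
    destruct (classic (d ∙ n = O)) as [E|E].
    - rewrite E. destruct (classic (h ∙ n = O)) as [E'|E'];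
        [now rewrite E', ifz_0 | now rewrite (ifz_nz _ _ E')].
    - rewrite (d_uniq n E), Hh, ifz_0. reflexivity. }
  assert (Z1 : forall h, h ∙ n0 <> O -> Z ∙ h = F ∙ (W d)).
  { intros h Hh. apply ZE. intro n.
    destruct (classic (d ∙ n = O)) as [E|E].
    - rewrite E. destruct (classic (h ∙ n = O)) as [E'|E'];
        [now rewrite E', ifz_0 | now rewrite (ifz_nz _ _ E')].
    - rewrite (d_uniq n E), (ifz_nz _ _ Hh). reflexivity. }
  apply Wd. rewrite <- (Z1 d Hn0), <- (Z0 ZEROS (zerosE n0)). symmetry. apply model_NPC.
  - unfold Z. std_tac.
  - apply in_C_intro. intro f. exists (S' n0). intros h Hh.
    specialize (Hh n0 (le_refl _)).
    destruct (classic (f ∙ n0 = O)) as [E|E].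
    + rewrite !Z0; congruence.
    + rewrite !Z1; congruence.
  - apply std_closed.
  - intros n Hn. rewrite zerosE, dE, (Hst n Hn).
    destruct (classic (SUM ∙ g ∙ n = O)) as [E|E];
      [now rewrite E, ifz_0 | now rewrite (ifz_nz _ _ E)].
Qed.

(* [g] is a standard function that tells whether [m < f k] for standard [k] and
   [m]; transfer for [g] turns the external predicate "[f k] is standard" into
   the internal one "[f k <= b k]". *)
Lemma standard_part_graph (f : M T1) : exists g b : M T1, std g /\ std b /\
  (forall k m, std k -> std m ->
     (lt m (f ∙ k) -> g ∙ (PAIR ∙ k ∙ m) = S' O) /\ (le (f ∙ k) m -> g ∙ (PAIR ∙ k ∙ m) = O)) /\
  (forall k, std k -> std (f ∙ k) -> le (f ∙ k) (b ∙ k)).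
Proof.
  (* At a pair [(k, m)] this is 1 if [m < f k] and 0 otherwise. Coding the region below the graph by
     a binary function makes STP applicable to an arbitrary [f]. *)
  set (c := den (λ N0, t_ifz · (t_monus · (#1 · (c_nth · #0 · Zero)) · (c_nth · #0 · (Succ · Zero)))
    · Zero · (Succ · Zero))%tm (vcons f vnil) : M T1).
  assert (cE : forall x, c ∙ x =
    IFZ ∙ (MONUS ∙ (f ∙ (CNTH ∙ x ∙ O)) ∙ (CNTH ∙ x ∙ (S' O))) ∙ O ∙ (S' O)).
  { intro x. unfold c. ev. reflexivity. }
  destruct (model_STP (f := c)) as (g & Hg & Ha).
  { intro n. rewrite cE. match goal with |- le (IFZ ∙ ?x ∙ _ ∙ _) _ =>
      destruct (classic (x = O)) as [E|E] end.
    - rewrite E, ifz_0. apply le_0.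
    - rewrite (ifz_nz _ _ E). apply le_refl. }
  assert (std_pair : forall k m, std k -> std m -> std (PAIR ∙ k ∙ m)).
  { intros. apply std_app; [apply std_app; [apply std_closed|]|]; assumption. }
  assert (gE : forall k m, std k -> std m ->
    (lt m (f ∙ k) -> g ∙ (PAIR ∙ k ∙ m) = S' O) /\ (le (f ∙ k) m -> g ∙ (PAIR ∙ k ∙ m) = O)).
  { intros k m Hk Hm. rewrite <- (Ha _ (std_pair k m Hk Hm)), cE, pair_fst, pair_snd. split; intro H.
    - apply ifz_nz. destruct (monus_lt H) as [j ->]. apply S_neq_0.
    - now rewrite (monus_le H), ifz_0. }
  (* Choice needs an internal formula, so the premise that [f k] is standard is replaced by the
     existence of a zero of [g (k, _)]. *)
  destruct (HAC_bound (s := N0)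
    (p := ((∃ N0, #3 · (t_pair · #2 · #0) ≐ Zero) ⟶
           ∃ N0, (∃ N0, t_add · #1 · #0 ≐ #2) ⩓ #3 · (t_pair · #2 · #0) ≐ Zero)%form)
    (e := vcons g vnil)) as (b & Hb & K).
  - cbn; tauto.
  - intros k Hk.
    destruct (classic (exists m, g ∙ (PAIR ∙ k ∙ m) = O)) as [[m Hm]|N].
    + assert (E : exists m, std m /\ g ∙ (PAIR ∙ k ∙ m) = O).
      { apply NNPP. intro N.
        (* The zero [m] may be infinite. As [t] is the standard indicator of the zeros, transfer
           yields a standard one. *)
        set (t := den (λ N0, t_ifz · (#1 · (t_pair · #2 · #0)) · (Succ · Zero) · Zero)%tm
          (vcons g (vcons k vnil)) : M T1).
        assert (tE : forall m, t ∙ m = IFZ ∙ (g ∙ (PAIR ∙ k ∙ m)) ∙ (S' O) ∙ O)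
          by (intro; unfold t; ev; reflexivity).
        assert (T0 : t ∙ m = O).
        { apply transfer; [unfold t; std_tac|]. intros n Hn. rewrite tE. apply ifz_nz.
          intro E. apply N. now exists n. }
        rewrite tE, Hm, ifz_0 in T0. now apply S_neq_0 in T0. }
      destruct E as (n & Hn & E). exists n. split; [exact Hn|]. intros _. exists n.
      split; [exact (le_refl n) | exact E].
    + exists O. split; [apply std_0|]. intro H. destruct (N H).
  - exists g, b. do 3 (split; [assumption|]). intros k Hk Hfk.
    destruct (K k Hk) as (y & Hy & H).
    destruct H as (m & Hm & E).
    { exists (f ∙ k). exact (proj2 (gE k _ Hk Hfk) (le_refl _)). }
    change (le m y) in Hm. change (g ∙ (PAIR ∙ k ∙ m) = O) in E.
    assert (Hmb : le m (b ∙ k)) by (eapply le_trans; eassumption).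
    destruct (le_or_lt (f ∙ k) m) as [H|H]; [eapply le_trans; eassumption|].
    (* Below the standard number [b k] the zero [m] is standard, so [g] tells the truth there and
       [m < f k] is impossible. *)
    rewrite (proj1 (gE k m Hk (std_le (std_app Hb Hk) Hmb)) H) in E. now apply S_neq_0 in E.
Qed.

Lemma sum_indicator f a n : le a n ->
  (forall m, lt m n -> (lt m a -> f ∙ m = S' O) /\ (le a m -> f ∙ m = O)) -> SUM ∙ f ∙ n = a.
Proof.
  intros [k <-] H.
  assert (A : forall j, le j a -> SUM ∙ f ∙ j = j).
  { refine (int_ind (p := ((∃ N0, t_add · #1 · #0 ≐ #3) ⟶ t_sum · #1 · #0 ≐ #0)%form)
      (e := vcons f (vcons a vnil)) _ _ _); [cbn; tauto | intros _; apply sum_0 |].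
    intros j IH Hj. change (le (S' j) a) in Hj. change (le j a -> SUM ∙ f ∙ j = j) in IH.
    change (SUM ∙ f ∙ (S' j) = S' j). rewrite sum_S, IH by now apply lt_le.
    rewrite (proj1 (H j (lt_le_trans Hj (le_add_r _ _)))) by exact Hj.
    now rewrite add_S_r, add_0_r. }
  assert (B : forall j, le j k -> SUM ∙ f ∙ (ADD ∙ a ∙ j) = a).
  { refine (int_ind (p := ((∃ N0, t_add · #1 · #0 ≐ #4) ⟶ t_sum · #1 · (t_add · #2 · #0) ≐ #2)%form)
      (e := vcons f (vcons a (vcons k vnil))) _ _ _); [cbn; tauto | |].
    - intros _. change (SUM ∙ f ∙ (ADD ∙ a ∙ O) = a). rewrite add_0_r. apply A, le_refl.
    - intros j IH Hj. change (le (S' j) k) in Hj. change (le j k -> SUM ∙ f ∙ (ADD ∙ a ∙ j) = a) in IH.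
      change (SUM ∙ f ∙ (ADD ∙ a ∙ (S' j)) = a). rewrite add_S_r, sum_S, IH by now apply lt_le.
      rewrite (proj2 (H (ADD ∙ a ∙ j) ltac:(destruct Hj as [i <-]; exists i;
        now rewrite !add_S_l, add_S_r, add_assoc)) (le_add_r _ _)).
      apply add_0_r. }
  apply B, le_refl.
Qed.

(** STP applies to binary functions only. Here [f k] is recovered as the sum over [m < b k] of the
    values of [g] that tell whether [m < f k], a term in the standard [g] and [b]. *)
Lemma standard_part (f : M T1) : (forall k, std k -> std (f ∙ k)) ->
  exists h, std h /\ approx f h.
Proof.
  intro Hf. destruct (standard_part_graph f) as (g & b & Hg & Hb & HgE & Hfb).
  exists (den (λ N0, t_sum · (λ N0, #2 · (t_pair · #1 · #0)) · (#2 · #0))%tm (vcons g (vcons b vnil))).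
  split; [std_tac|].
  intros k Hk. ev. symmetry. apply sum_indicator; [now apply Hfb; auto|].
  intros m Hm. ev. apply HgE; [exact Hk|].
  apply (std_le (std_app Hb Hk)). now apply lt_le.
Qed.

(** * Bar induction along a standard path *)

Lemma catf_approx s f g : approx f g -> approx (CATF ∙ s ∙ f) (CATF ∙ s ∙ g).
Proof.
  intros H i Hi. destruct (le_or_lt (CLEN ∙ s) i) as [[j <-]|K].
  - rewrite !catf_ge. apply H. exact (std_le Hi (le_add_l _ _)).
  - now rewrite !catf_lt.
Qed.

(* [s * 0 * (fun n => F (s * (n + 1)))] *)
Definition unfold_seq (F : M T1) (s : num) : M T1 :=
  CATF ∙ (CCAT ∙ s ∙ (CUNIT ∙ O)) ∙ den (λ N0, #1 · (t_snoc · #2 · #0))%tm (vcons F (vcons s vnil)).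

(** The shared recursion equation of H and G at an infinite bound. Agreement at standard arguments
    is all that NPC needs, and it leaves room for the finite list that H uses in place of an
    infinite sequence. *)
Definition unfolds (Y : M T2) (F : M T1) :=
  forall s, std s -> exists u, F ∙ s = Y ∙ u /\ approx u (unfold_seq F s).

Lemma unfold_seq_lt F s i : lt i (CLEN ∙ s) -> unfold_seq F s ∙ i = CNTH ∙ s ∙ i.
Proof.
  intro H. unfold unfold_seq. rewrite catf_lt.
  - now apply cnth_cat_lt.
  - rewrite clen_cat. eapply lt_le_trans; [exact H | apply le_add_r].
Qed.

(* If no child [s * (n + 1)] with [n] standard is bad, then the two child
   functions have a common standard part [h], so NPC evaluates [Y] at
   [s * 0 * h] for both. *)
Lemma bad_child Y F1 F2 b s : std Y -> in_C Y -> unfolds Y F1 -> unfolds Y F2 -> std b ->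
  (forall k, std k -> std (F1 ∙ k) -> le (F1 ∙ k) (b ∙ k)) ->
  std s ->
  (forall n, std n -> F1 ∙ (SNOC ∙ s ∙ n) = F2 ∙ (SNOC ∙ s ∙ n) /\
     le (F1 ∙ (SNOC ∙ s ∙ n)) (b ∙ (SNOC ∙ s ∙ n))) ->
  F1 ∙ s = F2 ∙ s /\ le (F1 ∙ s) (b ∙ s).
Proof.
  intros HY HC H1 H2 Hb HbE Hs Hgood.
  assert (std_snoc : forall n, std n -> std (SNOC ∙ s ∙ n)).
  { intros n Hn. apply std_app; [apply std_app; [apply std_closed|]|]; assumption. }
  set (f := fun F : M T1 => den (λ N0, #1 · (t_snoc · #2 · #0))%tm (vcons F (vcons s vnil)) : M T1).
  assert (fE : forall F n, f F ∙ n = F ∙ (SNOC ∙ s ∙ n)) by (intros; unfold f; ev; reflexivity).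
  (* The bound by the standard [b] makes the values at the children standard; equality of [F1] and
     [F2] alone would not. *)
  destruct (standard_part (f := f F1)) as (h & Hh & Ha).
  { intros n Hn. rewrite fE. eapply std_le; [|apply Hgood, Hn].
    apply std_app; auto. }
  assert (Ha2 : approx (f F2) h).
  { intros n Hn. rewrite <- (Ha n Hn), !fE. symmetry. now apply Hgood. }
  set (w := CATF ∙ (CCAT ∙ s ∙ (CUNIT ∙ O)) ∙ h).
  assert (Hw : std w).
  { change (std (den (c_catf · (c_cat · #0 · (c_unit · Zero)) · #1)%tm (vcons s (vcons h vnil)))).
    std_tac. }
  assert (Y_eq : forall F, unfolds Y F -> approx (f F) h -> F ∙ s = Y ∙ w).
  { intros F HF Hfh. destruct (HF s Hs) as (u & -> & Hu). symmetry. apply model_NPC; auto.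
    intros i Hi. rewrite (Hu i Hi). symmetry. exact (catf_approx _ Hfh Hi). }
  pose proof (Y_eq F1 H1 Ha) as E1. pose proof (Y_eq F2 H2 Ha2) as E2.
  split; [congruence|]. apply HbE; [exact Hs|]. rewrite E1. now apply std_app.
Qed.

Lemma unfolds_unique Y F1 F2 : std Y -> in_C Y -> unfolds Y F1 -> unfolds Y F2 ->
  forall s, std s -> F1 ∙ s = F2 ∙ s.
Proof.
  intros HY HC H1 H2 s0 Hs0.
  destruct (standard_part_graph F1) as (_ & b & _ & Hb & _ & HbE).
  (* Both truncated differences of [F1 s] and [F2 s] plus the excess of [F1 s] over [b s]: zero
     exactly where the node is good. *)
  set (bad := den (λ N0, t_add · (t_add · (t_monus · (#1 · #0) · (#2 · #0)) · (t_monus · (#2 · #0) · (#1 · #0)))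
    · (t_monus · (#1 · #0) · (#3 · #0)))%tm (vcons F1 (vcons F2 (vcons b vnil))) : M T1).
  assert (badE : forall s, bad ∙ s = O <-> F1 ∙ s = F2 ∙ s /\ le (F1 ∙ s) (b ∙ s)).
  { intro s. unfold bad. ev. split.
    - intro H. apply add_eq_0 in H. destruct H as [H K]. apply add_eq_0 in H. destruct H as [H H'].
      split; [apply le_antisym|]; now apply monus_eq_0.
    - intros [-> K]. now rewrite (monus_le K), (monus_le (le_refl _)), !add_0_r. }
  apply NNPP. intro Hne.
  (* Each stage appends [n + 1] for the first [n] below [L] with a bad child, or for [n = L] if
     there is none. The infinite bound reaches every standard child. *)
  set (path := den (λ N0, Rec · #0 · #1 · (λ N0, λ N0, t_snoc · #1 · (t_search · (λ N0, #5 · (t_snoc · #2 · #0)) · #5)))%tm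
    (vcons s0 (vcons bad (vcons L vnil))) : M T1).
  assert (path_0 : path ∙ O = s0) by (unfold path; ev; apply rec_0).
  assert (path_S : forall k, exists q : M T1, (forall n, q ∙ n = bad ∙ (SNOC ∙ (path ∙ k) ∙ n)) /\
    path ∙ (S' k) = SNOC ∙ (path ∙ k) ∙ (SEARCH ∙ q ∙ L)).
  { intro k. exists (den (λ N0, #1 · (t_snoc · #2 · #0))%tm (vcons bad (vcons (path ∙ k) vnil))).
    split; [intro n; ev; reflexivity|].
    unfold path at 1. ev. rewrite rec_S. ev. f_equal; [f_equal|].
    - unfold path. ev. reflexivity.
    - f_equal. f_equal. apply ext. intro n. ev. f_equal. f_equal. f_equal. unfold path. ev. reflexivity. }
  (* External induction, since the formula mentions standardness. The claims about [path] below are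
     internal and hold at every stage. *)
  assert (path_bad : forall k, std k -> std (path ∙ k) /\ bad ∙ (path ∙ k) <> O).
  { refine (st_ind (p := (St (#1 · #0) ⩓ ¬ (#2 · (#1 · #0) ≐ Zero))%form)
      (e := vcons path (vcons bad vnil)) _ _).
    - change (std (path ∙ O) /\ bad ∙ (path ∙ O) <> O). rewrite path_0. split; [exact Hs0|].
      rewrite badE. tauto.
    - intros k Hk IH. change (std (path ∙ k) /\ bad ∙ (path ∙ k) <> O) in IH.
      change (std (path ∙ (S' k)) /\ bad ∙ (path ∙ (S' k)) <> O).
      destruct IH as [Hs Hbad], (path_S k) as (q & Hq & ->).
      assert (Hn : exists n, std n /\ q ∙ n <> O).
      { apply NNPP. intro N. apply Hbad, badE.
        apply (bad_child (Y := Y)); auto. intros n Hn. apply badE.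
        apply NNPP. intro E. apply N. exists n. split; [exact Hn|]. now rewrite Hq. }
      destruct Hn as (n & Hn & Hqn).
      (* The search ends no later than at a standard bad child, so its result is standard and cannot
         be the default [L]. *)
      assert (Hm : std (SEARCH ∙ q ∙ L)) by exact (std_le Hn (search_le L Hqn)).
      split.
      + apply std_app; [apply std_app; [apply std_closed|]|]; assumption.
      + rewrite <- Hq. destruct (search_cases q L) as [E|E]; [|exact E].
        rewrite E in Hm. contradiction. }
  assert (path_len : forall k, le k (CLEN ∙ (path ∙ k))).
  { refine (int_ind (p := (∃ N0, t_add · #1 · #0 ≐ c_len · (#2 · #1))%form)
      (e := vcons path vnil) I _ _).
    - change (le O (CLEN ∙ (path ∙ O))). apply le_0.
    - intros k IH. change (le k (CLEN ∙ (path ∙ k))) in IH. change (le (S' k) (CLEN ∙ (path ∙ (S' k)))).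
      destruct (path_S k) as (q & _ & ->). rewrite clen_snoc. now apply le_S_S. }
  assert (path_nth : forall i j, CNTH ∙ (path ∙ (ADD ∙ (S' i) ∙ j)) ∙ i = CNTH ∙ (path ∙ (S' i)) ∙ i).
  { intros i j. revert j.
    refine (int_ind (p := (c_nth · (#1 · (t_add · (Succ · #2) · #0)) · #2 ≐ c_nth · (#1 · (Succ · #2)) · #2)%form)
      (e := vcons path (vcons i vnil)) I _ _).
    - change (CNTH ∙ (path ∙ (ADD ∙ (S' i) ∙ O)) ∙ i = CNTH ∙ (path ∙ (S' i)) ∙ i). now rewrite add_0_r.
    - intros j IH. change (CNTH ∙ (path ∙ (ADD ∙ (S' i) ∙ j)) ∙ i = CNTH ∙ (path ∙ (S' i)) ∙ i) in IH.
      change (CNTH ∙ (path ∙ (ADD ∙ (S' i) ∙ (S' j))) ∙ i = CNTH ∙ (path ∙ (S' i)) ∙ i).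
      rewrite add_S_r. destruct (path_S (ADD ∙ (S' i) ∙ j)) as (q & _ & ->).
      rewrite snocE, cnth_cat_lt; [exact IH|].
      eapply le_trans; [apply le_add_r | apply path_len]. }
  (* The limit of the path. The start [s0] may be nonempty, but entry [i] is fixed from stage
     [i + 1] on. *)
  set (a := den (λ N0, c_nth · (#1 · (Succ · #0)) · #0)%tm (vcons path vnil) : M T1).
  assert (aE : forall i, a ∙ i = CNTH ∙ (path ∙ (S' i)) ∙ i) by (intro; unfold a; ev; reflexivity).
  destruct (standard_part (f := a)) as (h & Hh & Ha).
  { intros i Hi. rewrite aE. apply std_app; [apply std_app; [apply std_closed|]|exact Hi].
    now apply path_bad, std_S. }
  destruct (std_modulus HY HC Hh) as (n & Hn & Hmod).
  destruct (path_bad n Hn) as [Hs Hbad]. set (s := path ∙ n) in *.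
  (* The node reached after [n] steps has at least [n] entries, and its first [n] are those of [h].
     So the modulus forces the same standard value [Y h] for every such [F]. *)
  assert (Y_eq : forall F, unfolds Y F -> F ∙ s = Y ∙ h).
  { intros F HF. destruct (HF s Hs) as (u & -> & Hu). apply Hmod. intros i Hi.
    assert (Hi' : std i) by exact (std_le Hn (lt_le Hi)).
    rewrite (Hu i Hi'), <- (Ha i Hi'), aE, unfold_seq_lt.
    - destruct Hi as [j Hj]. unfold s. rewrite <- Hj. apply path_nth.
    - eapply lt_le_trans; [exact Hi | apply path_len]. }
  apply Hbad, badE. split; [now rewrite !Y_eq|]. apply HbE; [exact Hs|].
  rewrite (Y_eq F1 H1). now apply std_app.
Qed.

(** * The functionals H and G at an infinite bound *)

Definition at_G (Y : M T2) (N : num) : M T1 := den (λ N0, fun_G · #1 · #0 · #2)%tm (vcons Y (vcons N vnil)).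
Definition at_H (Y : M T2) (N : num) : M T1 := den (λ N0, fun_H · #1 · #0 · #2)%tm (vcons Y (vcons N vnil)).

Lemma infinite_monus_clen N s : ~ std N -> std s -> exists k,
  MONUS ∙ N ∙ (CLEN ∙ s) = S' k /\ forall n, MONUS ∙ N ∙ (CLEN ∙ (SNOC ∙ s ∙ n)) = k.
Proof.
  intros HN Hs. destruct (monus_lt (m := N) (n := CLEN ∙ s)) as [k Hk].
  - apply std_lt_infinite; [apply std_app; [apply std_closed | exact Hs] | exact HN].
  - exists k. split; [exact Hk|]. intro n. now rewrite clen_snoc, monus_S_r, Hk, pred_S.
Qed.

Lemma unfolds_G Y N : ~ std N -> unfolds Y (at_G Y N).
Proof.
  intros HN s Hs.
  (* The base and step of the recursor refer to [Y] and the bound only; [O] fills the unread place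
     of [s]. Hence [s] and its children share them, and a child uses the counter [k], one less than
     that of [s]. *)
  set (e := vcons N (vcons O (vcons Y vnil))).
  set (base := den (λ N0, #3 · (c_catf · #0 · zeros))%tm e : M T1).
  set (step := den (λ T1, λ N0, λ N0,
            #5 · (c_catf · (c_cat · #0 · (c_unit · Zero))
                   · (λ N0, #3 · (c_cat · #1 · (c_unit · (Succ · #0))))))%tm e
            : M (T1 ⇒ N0 ⇒ T1)%ty).
  assert (FE : forall s, at_G Y N ∙ s = d_rec M T1 ∙ (MONUS ∙ N ∙ (CLEN ∙ s)) ∙ base ∙ step ∙ s).
  { intro s'. unfold at_G, fun_G. ev. reflexivity. }
  destruct (infinite_monus_clen HN Hs) as (k & Hk & Hk').
  rewrite FE, Hk, rec_S. set (h := d_rec M T1 ∙ k ∙ base ∙ step).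
  unfold step, e. ev. eexists. split; [reflexivity|].
  apply catf_approx. intros n _. ev. now rewrite FE, Hk', snocE.
Qed.

(** H lists only [N] children and continues with zeros. A standard position in that list lies below
    the infinite [N], so the truncation is not seen there. *)
Lemma unfolds_H Y N : ~ std N -> unfolds Y (at_H Y N).
Proof.
  intros HN s Hs.
  set (e := vcons N (vcons O (vcons Y vnil))).
  set (base := den (λ N0, #3 · (c_catf · (c_init · (c_nth · #0) · #1) · zeros))%tm e : M T1).
  set (step := den (λ T1, λ N0, λ N0,
            #5 · (c_catf
              · (c_cat · (c_cat · #0 · (c_unit · Zero))
                  · (c_init · (λ N0, #3 · (c_cat · #1 · (c_unit · (Succ · #0)))) · #3))
              · zeros))%tm e : M (T1 ⇒ N0 ⇒ T1)%ty).
  assert (FE : forall s, at_H Y N ∙ s = d_rec M T1 ∙ (MONUS ∙ N ∙ (CLEN ∙ s)) ∙ base ∙ step ∙ s).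
  { intro s'. unfold at_H, fun_H. ev. reflexivity. }
  destruct (infinite_monus_clen HN Hs) as (k & Hk & Hk').
  rewrite FE, Hk, rec_S. set (h := d_rec M T1 ∙ k ∙ base ∙ step).
  unfold step, e. ev. eexists. split; [reflexivity|].
  intros i Hi. unfold unfold_seq. set (s1 := CCAT ∙ s ∙ (CUNIT ∙ O)).
  match goal with |- CATF ∙ (CCAT ∙ s1 ∙ (CINIT ∙ ?q ∙ N)) ∙ _ ∙ i = _ => set (f := q) end.
  assert (Hc : CLEN ∙ (CINIT ∙ f ∙ N) = N) by now rewrite clenE, dec_init, init_len.
  destruct (le_or_lt (CLEN ∙ s1) i) as [[j <-]|K].
  - assert (Hj : lt j N) by exact (std_lt_infinite (std_le Hi (le_add_l _ _)) HN).
    rewrite catf_ge, catf_lt, cnth_cat_ge, cnthE, dec_init, (init_nth f Hj).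
    + unfold f. ev. now rewrite FE, Hk', snocE.
    + rewrite clen_cat, Hc. destruct Hj as [m <-]. exists m.
      now rewrite !add_S_l, add_S_r, add_assoc.
  - rewrite !catf_lt, cnth_cat_lt; auto.
    rewrite clen_cat. eapply lt_le_trans; [exact K | apply le_add_r].
Qed.

End Model.

Theorem theorem4p1 :
  P_NPC_STP ⊢
    ∀st T2, inC #0 ⟶ ∀st N0, ∀ N0, ∀ N0,     (* Y, s, M, N *)
      infinite #1 ⩓ infinite #0 ⟶
        fun_H · #3 · #2 · #0 ≐ fun_H · #3 · #2 · #1 ⩓
        fun_G · #3 · #2 · #0 ≐ fun_G · #3 · #2 · #1.
Proof.
  apply completeness.
  - exact P_NPC_STP_subst_closed.
  - intros. now apply PNS_P, P_EPA.
  - intros. apply PNS_P, P_st_eq.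
  - intros M HM Y HY HC s Hs m n [Hm Hn].
    assert (E : forall N, app (at_H Y N) s = app (app (app (den fun_H vnil) Y) s) N /\
      app (at_G Y N) s = app (app (app (den fun_G vnil) Y) s) N).
    { intro N. split; exact (beta HM _ _ _). }
    split.
    + change (app (app (app (den fun_H vnil) Y) s) n = app (app (app (den fun_H vnil) Y) s) m).
      rewrite <- (proj1 (E n)), <- (proj1 (E m)).
      (* The infinite [m] also serves as the search bound [L]. *)
      exact (unfolds_unique HM Hm HY HC (unfolds_H HM _ Hn) (unfolds_H HM _ Hm) Hs).
    + change (app (app (app (den fun_G vnil) Y) s) n = app (app (app (den fun_G vnil) Y) s) m).
      rewrite <- (proj2 (E n)), <- (proj2 (E m)).
      exact (unfolds_unique HM Hm HY HC (unfolds_G HM _ Hn) (unfolds_G HM _ Hm) Hs).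
Qed.
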